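(* Suppose that the pair $(\mathbf{X},\mathbf{Y})$ is good. Then: (A) $$\mathbf{H}(\mathbf{X}\cdot\mathbf{Y}\mid\mathbf{Y})=\mathbb{P}(Y_0=1)\,\mathbb{E}_{Y_0=1}\Big[\mathbf{H}\big(X_0\mid X_{\{r_{-1},r_{-2},\ldots\}}\big)\big|_{r_{-i}=R_{-i}}\Big].$$ (B) If additionally $\mathbf{Y}$ is ergodic, then $$\mathbf{H}(\mathbf{X}\cdot\mathbf{Y}\mid\mathbf{Y})=\mathbf{H}(\mathbf{X})-\mathbb{P}(Y_0=1)\,\mathbb{E}_{Y_0=1}\Big[\mathbf{H}\big(X_{[1,r_1-1]}\mid X_{(-\infty,0]},X_{\{r_1,r_2,\ldots\}}\big)\big|_{r_i=R_i}\Big].$$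
   Context: All processes are bilateral (indexed by $\mathbb{Z}$), real-valued and defined on a probability space $(\Omega,\mathcal{F},\mathbb{P})$. The pair $(\mathbf{X},\mathbf{Y})$, $\mathbf{X}=(X_i)_{i\in\mathbb{Z}}$, $\mathbf{Y}=(Y_i)_{i\in\mathbb{Z}}$, is called good if: $\mathbf{X}$ and $\mathbf{Y}$ are stationary; $\mathbf{X}$ takes values in a finite set; $Y_i\in\{0,1\}$ and $\mathbb{P}(Y_0=1)>0$; $\mathbf{X}$ and $\mathbf{Y}$ are independent; and the return process $\mathbf{R}$ below is well defined almost surely, i.e. almost surely $Y_i=1$ for infinitely many $i\ge 0$ and infinitely many $i\le 0$. The return process $\mathbf{R}=(R_i)_{i\in\mathbb{Z}}$ is $R_0=\inf\{j\ge 0: Y_j=1\}$, $R_i=\inf\{j>R_{i-1}:Y_j=1\}$ for $i\ge1$, $R_i=\sup\{j<R_{i+1}:Y_j=1\}$ for $i\le -1$. $\mathbf{X}\cdot\mathbf{Y}=(X_iY_i)_{i\in\mathbb{Z}}$. $\mathbb{E}_{Y_0=1}$ is expectation under $\mathbb{P}(\,\cdot\mid Y_0=1)$ (under which $R_0=0$). $\mathbf{H}(X)$ and $\mathbf{H}(X\mid Y)$ for finitely-valued random variables denote Shannon entropy and conditional Shannon entropy (base-2 logarithm); $\mathbf{H}(X\mid\mathcal{G})$ is the conditional entropy given a $\sigma$-algebra, and conditioning on a (possibly infinite) family of variables means conditioning on the $\sigma$-algebra it generates (equivalently, the limit of the conditional entropies along increasing finite subfamilies). For a set $A\subset\mathbb{Z}$,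 $X_A=(X_i)_{i\in A}$; $[k,\ell]=\{k,\ldots,\ell\}$ (empty if $\ell<k$), $(-\infty,\ell]$ is the set of integers $\le\ell$, and the entropy of $X_\emptyset$ is $0$. For processes with $(\mathbf{Z},\mathbf{W})$ stationary and finitely valued, $\mathbf{H}(\mathbf{Z})=\lim_n\frac1n\mathbf{H}(Z_{[0,n-1]})$ is the entropy rate and $\mathbf{H}(\mathbf{Z}\mid\mathbf{W})=\lim_n\frac1n\mathbf{H}(Z_{[0,n-1]}\mid W_{[0,n-1]})$ is the relative entropy rate. An expression $\mathbb{E}_{Y_0=1}[f(\mathbf{r})|_{\mathbf{r}=\mathbf{R}}]$ means: compute the number $f(\mathbf{r})$ for each deterministic integer sequence $\mathbf{r}$ (a realization of $\mathbf{R}$), then take $\mathbb{E}_{Y_0=1}f(\mathbf{R})$. *)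

(* Defs.v *)
From HB Require Import structures.
From mathcomp Require Import all_boot all_order all_algebra.
From mathcomp Require Import all_classical all_reals all_analysis.
From mathcomp Require Import measurable_realfun.

Set Implicit Arguments.
Unset Strict Implicit.
Unset Printing Implicit Defensive.

Import Order.TTheory GRing.Theory Num.Theory.
Import numFieldNormedType.Exports.

Local Open Scope classical_set_scope.
Local Open Scope ring_scope.

Section sigma_algebras.
Context {aT : Type} {R : realType}.

(* The sigma-algebra on aT generated by the real functions f i, i in A *)
Definition sigma_family (f : int -> aT -> R) (A : set int) : set (set aT) :=
  <<s \bigcup_(i in A) preimage_set_system setT (f i) measurable >>.

End sigma_algebras.

(* The product (cylinder) sigma-algebra of R^Z *)
Definition product_sigma (R : realType) : set (set (int -> R)) :=
  sigma_family (fun i (x : int -> R) => x i) setT.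

Definition shift {V : Type} (x : int -> V) : int -> V := fun i => x (i + 1).

Section processes.
Context {d : measure_display} {T : measurableType d} {R : realType}.
Variable P : probability T R.

Definition process := int -> {RV P >-> R}.

Implicit Types X Y : process.

Definition trajectory X (w : T) : int -> R := fun i => X i w.

Definition stationary X := forall A : set (int -> R), product_sigma A ->
  P [set w | A (shift (trajectory X w))] = P [set w | A (trajectory X w)].

Definition independent_processes X Y := forall A B : set (int -> R),
  product_sigma A -> product_sigma B ->
  P [set w | A (trajectory X w) /\ B (trajectory Y w)] =
  (P [set w | A (trajectory X w)] * P [set w | B (trajectory Y w)])%E.

(* Every shift-invariant event of R^Z is trivial under the law of Y.
   Stationarity is not included. *)
Definition ergodic Y := forall A : set (int -> R), product_sigma A ->
  [set x | A (shift x)] = A ->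
  P [set w | A (trajectory Y w)] = 0%E \/ P [set w | A (trajectory Y w)] = 1%E.

Definition mul_process X Y : process := fun i => X i * Y i.

Definition good X Y :=
  [/\ stationary X /\ stationary Y,
      exists2 S : set R, finite_set S & forall i w, S (X i w),
      (forall i w, Y i w = 0 \/ Y i w = 1) /\ (0 < P (Y 0%R @^-1` [set 1%R]))%E,
      independent_processes X Y &
      {ae P, forall w,
        infinite_set [set i : int | 0 <= i /\ Y i w = 1] /\
        infinite_set [set i : int | i <= 0 /\ Y i w = 1]}].

End processes.

(* Least and greatest element of a set of integers; the value is irrelevant
   when there is none. *)
Definition int_min (A : set int) : int :=
  xget 0 [set m | A m /\ forall j, A j -> m <= j].
Definition int_max (A : set int) : int :=
  xget 0 [set m | A m /\ forall j, A j -> j <= m].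

(* Successive elements of S from 0 on, and before the first one of those *)
Fixpoint return_fwd (S : set int) (n : nat) : int :=
  if n is n'.+1 then int_min [set j | return_fwd S n' < j /\ S j]
  else int_min [set j | 0 <= j /\ S j].

Fixpoint return_bwd (S : set int) (n : nat) : int :=
  int_max [set j |
    j < (if n is n'.+1 then return_bwd S n' else return_fwd S 0) /\ S j].

Definition return_seq (S : set int) (i : int) : int :=
  match i with
  | Posz n => return_fwd S n
  | Negz n => return_bwd S n   (* Negz n is - n.+1 *)
  end.

Section return_process.
Context {d : measure_display} {T : measurableType d} {R : realType}.
Variable P : probability T R.

Definition return_process (Y : process P) (w : T) : int -> int :=
  return_seq [set j | Y j w = 1].

(* P( . | A ), for A of positive probability *)
Definition cond_probability (A : set T) (mA : measurable A) :
    probability T R :=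
  mnormalize (mrestr P mA) P.

Definition given_eq1 (Y : {RV P >-> R}) : probability T R :=
  cond_probability (measurable_funPTI Y (measurable_set1 1)).

End return_process.

Section entropy.
Context {d : measure_display} {T : measurableType d} {R : realType}.
Variable P : probability T R.

Definition log2 (x : R) : R := ln x / ln 2.

(* 0 log 0 = 0 holds because ln 0 = 0 in the library. *)
Definition entropy_term (p : R) : R := - (p * log2 p).

(* Z : T -> V and W : T -> V' are finitely valued in what follows; the finitely
   supported sums below are then the ordinary sums over their ranges. *)
Definition shannon_entropy {V : choiceType} (Z : T -> V) : R :=
  \sum_(v \in range Z) entropy_term (fine (P (Z @^-1` [set v]))).

Definition cond_shannon_entropy {V V' : choiceType}
    (Z : T -> V) (W : T -> V') : R :=
  \sum_(u \in range W)
    (fine (P (W @^-1` [set u])) *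
     \sum_(v \in range Z)
       entropy_term (fine (P (Z @^-1` [set v] `&` W @^-1` [set u])) /
                     fine (P (W @^-1` [set u])))).

Definition is_cond_prob (G : set (set T)) (B : set T) (f : T -> R) :=
  [/\ forall C : set R, measurable C -> G (f @^-1` C),
      P.-integrable setT (EFin \o f) &
      forall A, G A -> (\int[P]_(w in A) (f w)%:E)%E = P (A `&` B)].

(* A version of P(B | G), for a sub-sigma-algebra G *)
Definition cond_prob (G : set (set T)) (B : set T) : T -> R :=
  xget (fun=> 0) (is_cond_prob G B).

(* H(Z | G) : expectation of the entropy of the conditional law of Z given G *)
Definition sigma_cond_entropy {V : choiceType} (Z : T -> V)
    (G : set (set T)) : \bar R :=
  (\int[P]_w
     (\sum_(v \in range Z)
        entropy_term (cond_prob G (Z @^-1` [set v]) w))%:E)%E.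

(* X_A, encoded as the trajectory replaced by a constant outside of A *)
Definition coords (X : process P) (A : set int) (w : T) : int -> R :=
  trajectory X w \_ A.

Definition first_ints (n : nat) : set int := [set i | 0 <= i < n%:Z].

Definition entropy_rate (Z : process P) : R :=
  limn (fun n => shannon_entropy (coords Z (first_ints n)) / n%:R).

Definition relative_entropy_rate (Z W : process P) : R :=
  limn (fun n => cond_shannon_entropy (coords Z (first_ints n))
                                      (coords W (first_ints n)) / n%:R).

(* H(Z | X_B) *)
Definition entropy_given_coords {V : choiceType} (Z : T -> V) (X : process P)
    (B : set int) : \bar R :=
  sigma_cond_entropy Z (sigma_family (fun i => X i) B).

End entropy.

(* Main.v *)
From HB Require Import structures.
Require Import Defs.
From mathcomp Require Import all_boot all_order all_algebra finmap.
From mathcomp Require Import all_classical all_reals all_analysis.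
From mathcomp Require Import measurable_realfun.
From mathcomp Require Import ring lra zify.

Import Order.TTheory GRing.Theory Num.Theory.
Import numFieldNormedType.Exports.

Set Implicit Arguments.
Unset Strict Implicit.
Unset Printing Implicit Defensive.

Local Open Scope classical_set_scope.
Local Open Scope ring_scope.

(** Write S for the random set of the sites i with Y_i = 1, H(A) for the
    entropy of X_A and e(A | B) for H(X_A | X_B).

    Given Y, the process X Y shows X along S only. As Y is independent of X,
    H(XY_[0,n) | Y_[0,n)) is the average of H(S cap [0,n)) over the realizations
    of S ([cond_shannon_entropy_mul]). By the chain rule, the site n adds
    e(n | S cap [0,n)) to it if n is in S. Shifting by n, which preserves the law
    of S as well as block entropies, moves this increment to the site 0, where it
    reads e(0 | S cap [-n,0)) and decreases to e(0 | S cap (-oo,0)). The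
    increments converge by dominated convergence and the averages by Cesaro:
    this is the first formula ([cvg_mean_block_entropy]), since
    S cap (-oo,0) = {R_-1, R_-2, ...} when 0 is in S.

    For the second formula, the sites of [0,n) that are not in S are put back
    from left to right. Putting back k adds e(k | [0,k) u (S cap (k,n))), that is,
    after a shift, e(0 | [-k,0) u (S cap (0,n-1-k])). Hence
    H([0,n)) - E H(S cap [0,n)) is a sum along an antidiagonal, and divided by n
    it converges to the mean of e(0 | (-oo,0) u S) on the event that 0 is not in S
    ([cvg_mean_gap_entropy]). A Kac-type argument turns this mean over all gap
    sites into one over the gaps that start at 0 ([integral_excursion_entropy]):
    decompose according to the last site of S before 0, shift that site to 0, and
    add up the gap (1, ..., R_1 - 1) with the chain rule
    ([coords_entropy_excursion]).

    Both arguments need e(A | B) for infinite B, defined by conditional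
    probabilities, to be the limit of e(A | B_n) for finite B_n increasing to B
    ([cvg_entropy_given_coords]). The conditional probabilities exist by
    Radon-Nikodym. They are approximated in L1 by functions of finitely many
    coordinates, because the approximable events form a sigma-algebra, and the
    tangent inequality for - x log x turns this into closeness of entropies;
    the same inequality gives Jensen's inequality, hence the monotonicity of
    e(A | B) in B. *)

(** * Expectations of bounded functions *)

Section expectation.
Context {d : measure_display} {T : measurableType d} {R : realType}.
Variable P : probability T R.
Implicit Types f g : T -> R.

Local Notation Ex := (Rintegral P setT).

Definition bounded_measurable f :=
  measurable_fun setT f /\ exists M, forall w, `|f w| <= M.

Lemma bounded_measurable_integrable f :
  bounded_measurable f -> P.-integrable setT (EFin \o f).
Proof.
move=> [mf [M fM]]; apply: measurable_bounded_integrable => //.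
  exact: fin_num_fun_lty.
exists M; split; first exact: num_real.
by move=> x Mx w _ /=; rewrite (le_trans (fM w))// ltW.
Qed.
Local Hint Resolve bounded_measurable_integrable : core.

Lemma bounded_measurable_cst c : bounded_measurable (fun=> c).
Proof. by split; [exact: measurable_cst|exists `|c|]. Qed.

Lemma bounded_measurableD f g : bounded_measurable f -> bounded_measurable g ->
  bounded_measurable (fun w => f w + g w).
Proof.
move=> [mf [M fM]] [mg [N gN]]; split; first exact: measurable_funD.
by exists (M + N) => w; rewrite (le_trans (ler_normD _ _))// lerD.
Qed.

Lemma bounded_measurableM f g : bounded_measurable f -> bounded_measurable g ->
  bounded_measurable (fun w => f w * g w).
Proof.
move=> [mf [M fM]] [mg [N gN]]; split; first exact: measurable_funM.
by exists (M * N) => w; rewrite normrM ler_pM.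
Qed.

Lemma bounded_measurableN f : bounded_measurable f ->
  bounded_measurable (fun w => - f w).
Proof.
move=> [mf [M fM]]; split; first exact: measurableT_comp.
by exists M => w; rewrite normrN.
Qed.

Lemma bounded_measurableB f g : bounded_measurable f -> bounded_measurable g ->
  bounded_measurable (fun w => f w - g w).
Proof. by move=> bf bg; apply/bounded_measurableD/bounded_measurableN. Qed.

Lemma bounded_measurable_norm f : bounded_measurable f ->
  bounded_measurable (fun w => `|f w|).
Proof.
move=> [mf [M fM]]; split; first exact: measurableT_comp.
by exists M => w; rewrite normr_id.
Qed.

Lemma bounded_measurable_max f g :
  bounded_measurable f -> bounded_measurable g ->
  bounded_measurable (fun w => Num.max (f w) (g w)).
Proof.
move=> [mf [M fM]] [mg [N gN]]; split; first exact: measurable_maxr.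
exists (Num.max M N) => w; rewrite le_max.
by have [_|_] := leP (f w) (g w); rewrite ?gN ?fM ?orbT.
Qed.

Lemma bounded_measurable_indic (A : set T) : measurable A ->
  bounded_measurable (\1_A).
Proof.
move=> mA; split; first exact: measurable_indic.
by exists 1 => w; rewrite indicE; case: (_ \in _); rewrite ?normr1 ?normr0.
Qed.

Lemma bounded_measurable_sum (I : eqType) (r : seq I) (F : I -> T -> R) :
  (forall i, i \in r -> bounded_measurable (F i)) ->
  bounded_measurable (fun w => \sum_(i <- r) F i w).
Proof.
elim: r => [_|i r IH H].
  by under eq_fun do rewrite big_nil; exact: bounded_measurable_cst.
under eq_fun do rewrite big_cons; apply: bounded_measurableD.
  by apply: H; rewrite mem_head.
by apply: IH => j jr; apply: H; rewrite inE jr orbT.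
Qed.

Lemma mean_cst c : Ex (fun=> c) = c.
Proof.
rewrite Rintegral_cst// -[RHS]mulr1; congr (_ * _).
by rewrite -[RHS]/(fine 1%E); congr fine; exact: probability_setT.
Qed.

Lemma meanD f g : bounded_measurable f -> bounded_measurable g ->
  Ex (fun w => f w + g w) = Ex f + Ex g.
Proof. by move=> bf bg; rewrite RintegralD//; exact: bounded_measurable_integrable. Qed.

Lemma meanB f g : bounded_measurable f -> bounded_measurable g ->
  Ex (fun w => f w - g w) = Ex f - Ex g.
Proof. by move=> bf bg; rewrite RintegralB//; exact: bounded_measurable_integrable. Qed.

Lemma meanZ c f : bounded_measurable f ->
  Ex (fun w => c * f w) = c * Ex f.
Proof. by move=> bf; rewrite RintegralZl//; exact: bounded_measurable_integrable. Qed.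

Lemma mean_sum (I : eqType) (r : seq I) (F : I -> T -> R) :
  (forall i, i \in r -> bounded_measurable (F i)) ->
  Ex (fun w => \sum_(i <- r) F i w) = \sum_(i <- r) Ex (F i).
Proof.
elim: r => [_|i r IH H].
  by under eq_fun do rewrite big_nil; rewrite mean_cst big_nil.
under eq_fun do rewrite big_cons.
have H' j : j \in r -> bounded_measurable (F j).
  by move=> jr; apply: H; rewrite inE jr orbT.
rewrite big_cons meanD ?IH//; first by apply: H; rewrite mem_head.
exact: bounded_measurable_sum.
Qed.

Lemma le_mean f g : bounded_measurable f -> bounded_measurable g ->
  (forall w, f w <= g w) -> Ex f <= Ex g.
Proof.
by move=> bf bg fg; apply: le_Rintegral => //; exact: bounded_measurable_integrable.
Qed.

Lemma mean_ge0 f : (forall w, 0 <= f w) -> 0 <= Ex f.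
Proof. by move=> f0; exact: Rintegral_ge0. Qed.

Lemma mean_indic (A : set T) : measurable A -> Ex \1_A = fine (P A).
Proof. by move=> mA; rewrite /Rintegral integral_indic// setIT. Qed.

Lemma mean_EFin f : bounded_measurable f ->
  ((Ex f)%:E = \int[P]_w (f w)%:E)%E.
Proof.
move=> bf; rewrite /Rintegral fineK//.
exact/integrable_fin_num/bounded_measurable_integrable.
Qed.

Definition finitely_valued {V : choiceType} (W : T -> V) :=
  finite_set (range W) /\ forall v, measurable (W @^-1` [set v]).

Section finitely_valued_variable.
Context {V : choiceType} (W : T -> V).
Hypothesis fW : finitely_valued W.

Lemma finitely_valued_preimage (C : set V) : measurable (W @^-1` C).
Proof.
have -> : W @^-1` C = \bigcup_(v in range W `&` C) (W @^-1` [set v]).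
  apply/seteqP; split => [w Cw|w [v [_ Cv] /= Wv]]; last by rewrite /= Wv.
  by exists (W w); [split; [exists w|]|].
have [finW mW] := fW; apply: fin_bigcup_measurable => //; exact: finite_setIl.
Qed.

Lemma function_of_finitely_valued (F : V -> R) (w : T) :
  F (W w) = \sum_(u <- fset_set (range W)) F u * \1_(W @^-1` [set u]) w.
Proof.
have [fin _] := fW.
have inW : W w \in fset_set (range W) by rewrite in_fset_set// inE; exists w.
rewrite (bigD1_seq (W w)) ?fset_uniq//=.
rewrite indicE mem_set// mulr1 big1_seq ?addr0// => u /andP[uW _].
by rewrite indicE memNset ?mulr0//= => Wwu; rewrite Wwu eqxx in uW.
Qed.

Lemma bounded_measurable_fun_of (F : V -> R) : bounded_measurable (F \o W).
Proof.
have -> : F \o W = fun w =>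
    \sum_(u <- fset_set (range W)) F u * \1_(W @^-1` [set u]) w.
  by apply/funext => w /=; rewrite function_of_finitely_valued.
apply: bounded_measurable_sum => u _.
by apply/bounded_measurableM/bounded_measurable_indic;
  [exact: bounded_measurable_cst|exact: finitely_valued_preimage].
Qed.

Lemma mean_fun_of f (F : V -> R) : bounded_measurable f ->
  Ex (fun w => f w * F (W w)) =
  \sum_(u \in range W) F u * Ex (fun w => f w * \1_(W @^-1` [set u]) w).
Proof.
move=> bf; have [fin _] := fW.
rewrite fsbig_finite//=.
have bi u : bounded_measurable (fun w => f w * \1_(W @^-1` [set u]) w).
  by apply/bounded_measurableM/bounded_measurable_indic/finitely_valued_preimage.
transitivity (Ex (fun w => \sum_(u <- fset_set (range W))
    F u * (f w * \1_(W @^-1` [set u]) w))).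
  congr Rintegral; apply/funext => w.
  rewrite function_of_finitely_valued mulr_sumr.
  by apply: eq_bigr => u _; rewrite mulrCA.
rewrite mean_sum; last first.
  by move=> u _; apply: bounded_measurableM => //; exact: bounded_measurable_cst.
by apply: eq_bigr => u _; rewrite meanZ.
Qed.

Lemma mean_fun_of1 (F : V -> R) :
  Ex (F \o W) = \sum_(u \in range W) F u * fine (P (W @^-1` [set u])).
Proof.
transitivity (Ex (fun w => 1 * F (W w))).
  by congr Rintegral; apply/funext => w; rewrite mul1r.
rewrite mean_fun_of; last exact: bounded_measurable_cst.
apply: eq_fsbigr => u _; rewrite -mean_indic//; last first.
  exact: finitely_valued_preimage.
by congr (_ * Rintegral _ _ _); apply/funext => w; rewrite mul1r.
Qed.

End finitely_valued_variable.

End expectation.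

(** * Bounded versions of conditional probabilities *)

Section conditional_probability.
Context {d : measure_display} {T : measurableType d} {R : realType}.
Variable P : probability T R.

Local Notation Ex := (Rintegral P setT).

Lemma null_set_of_integral_le0 (A : set T) (h : T -> R) : measurable A ->
  P.-integrable A (EFin \o h) -> (forall w, A w -> 0 < h w) ->
  (\int[P]_(w in A) (h w)%:E <= 0)%E -> P A = 0.
Proof.
move=> mA ih h0 ihle.
have mh := measurable_int P ih.
have /ae_eq_integral_abs : (\int[P]_(w in A) `|(h w)%:E| = 0)%E.
  apply/eqP; rewrite eq_le integral_ge0 ?andbT//.
  by rewrite (eq_integral (fun w => (h w)%:E))// => w; rewrite inE => Aw;
     rewrite gee0_abs// lee_fin ltW// h0.
move=> /(_ mA mh) [N [mN N0 subN]].
apply: (subset_measure0 mA mN _ N0) => w Aw; apply: subN => /= /(_ Aw).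
by move=> [] hw0; have := h0 _ Aw; rewrite hw0 ltxx.
Qed.

Section generated.
Variables (C : set (set T)) (B : set T).
Hypotheses (mC : forall A, C A -> measurable A) (mB : measurable B).

Lemma generated_measurable A : <<s C >> A -> measurable A.
Proof. by apply: smallest_sub => //; exact: sigma_algebra_measurable. Qed.

Local Notation TG := (g_sigma_algebraType C).

(** The identity, as a measurable map to the coarser space. *)
Definition coarsen : T -> TG := id.

Let measurable_coarsen : measurable_fun [set: T] coarsen.
Proof. by move=> _ A mA; rewrite setTI; exact: generated_measurable. Qed.

HB.instance Definition _ := isMeasurableFun.Build _ _ _ _ coarsen measurable_coarsen.

Definition trace_measure (A : set TG) : \bar R := P (A `&` B).

Let traceB0 : trace_measure set0 = 0%E.
Proof. by rewrite /trace_measure set0I measure0. Qed.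

Let traceB_ge0 A : (0 <= trace_measure A)%E.
Proof. exact: measure_ge0. Qed.

Let traceB_sigma_additive : semi_sigma_additive trace_measure.
Proof.
move=> F mF tF mU.
apply: (@measure_semi_sigma_additive _ _ _ (mrestr P mB) F) => //.
  by move=> n; exact: generated_measurable (mF n).
exact: generated_measurable.
Qed.

HB.instance Definition _ := isMeasure.Build _ _ _ trace_measure
  traceB0 traceB_ge0 traceB_sigma_additive.

Let traceB_fin : fin_num_fun trace_measure.
Proof.
move=> A mA; apply: fin_num_measure; apply: measurableI => //.
exact: generated_measurable.
Qed.

HB.instance Definition _ := Measure_isFinite.Build _ _ _ trace_measure traceB_fin.

(** Radon-Nikodym, applied on the sub-sigma-algebra itself so that the density
    is measurable for it. *)
Lemma is_cond_prob_exists : exists f, is_cond_prob P <<s C >> B f.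
Proof.
have dom : trace_measure `<< distribution P coarsen.
  apply/null_content_dominatesP => A mA PA0.
  apply: (@subset_measure0 _ _ _ P _ A) => //.
    by apply: measurableI => //; exact: generated_measurable.
  exact: generated_measurable.
have [g [g0 gfin ig gE]] := radon_nikodym_sigma_finite dom.
have mg : measurable_fun setT g := measurable_int _ ig.
have mfg : measurable_fun setT (fine \o g : TG -> R).
  exact: measurableT_comp.
exists (fine \o g); split.
- by move=> D mD; have := mfg measurableT D mD; rewrite setTI.
- have -> : EFin \o (fine \o g) = g by apply/funext => w /=; rewrite fineK.
  apply/integrableP; split; first exact: (measurableT_comp mg measurable_coarsen).
  move/integrableP : ig => [_]; apply: le_lt_trans.
  rewrite ge0_integral_distribution//; exact: measurableT_comp.
- move=> A GA; rewrite -[RHS]/(trace_measure A) (gE A GA).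
  rewrite ge0_integral_pushforward//; last exact: measurable_funTS.
  by apply: eq_integral => w _ /=; rewrite fineK.
Qed.

Lemma cond_probP : is_cond_prob P <<s C >> B (cond_prob P <<s C >> B).
Proof. by rewrite /cond_prob; apply: xgetPex; exact: is_cond_prob_exists. Qed.

(** Conditional probabilities are only determined almost everywhere; truncating
    one to [0, 1] produces a version with everywhere bounded values. *)
Lemma cond_prob_version : exists f : T -> R,
  [/\ forall w, 0 <= f w <= 1,
      forall D : set R, measurable D -> <<s C >> (f @^-1` D),
      forall A, <<s C >> A -> Ex (fun w => f w * \1_A w) = fine (P (A `&` B)) &
      {ae P, forall w, cond_prob P <<s C >> B w = f w}].
Proof.
have [mf intf fE] := cond_probP; set f := cond_prob _ _ _ in mf intf fE *.
have mfT : measurable_fun setT f.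
  by move=> _ D mD; rewrite setTI; exact: generated_measurable (mf _ mD).
have intfA A : measurable A -> P.-integrable A (EFin \o f).
  by move=> mA; exact: (integrableS measurableT).
have Pfin A : measurable A -> P A \is a fin_num by exact: fin_num_measure.
pose A0 := f @^-1` `]-oo, 0[; pose A1 := f @^-1` `]1, +oo[.
have GA0 : <<s C >> A0 by exact: mf.
have GA1 : <<s C >> A1 by exact: mf.
have mA0 := generated_measurable GA0; have mA1 := generated_measurable GA1.
(* Both events lie in the sub-sigma-algebra, so the integrals of f over them are
   probabilities, which forces the events to be null. *)
have PA0 : P A0 = 0.
  apply: (@null_set_of_integral_le0 _ (fun w => - f w)) => //.
  - have -> : EFin \o (fun w => - f w) = (\- (EFin \o f))%E by [].
    by apply: integrableN; exact: intfA.
  - by move=> w; rewrite /A0 /= in_itv /= oppr_gt0.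
  - under eq_integral do rewrite EFinN.
    rewrite integralN/=; last first.
      by apply: integrable_add_def => //; exact: intfA.
    rewrite fE// oppe_le0; exact: measure_ge0.
have PA1 : P A1 = 0.
  apply: (@null_set_of_integral_le0 _ (fun w => f w - 1)) => //.
  - have -> : EFin \o (fun w => f w - 1) = ((EFin \o f) \- cst 1)%E by [].
    apply: integrableB => //; first exact: intfA.
    exact: finite_measure_integrable_cst.
  - by move=> w; rewrite /A1 /= in_itv /= andbT subr_gt0.
  - under eq_integral do rewrite EFinB.
    rewrite integralB//=; last 2 first.
      exact: intfA.
      exact: (@finite_measure_integrable_cst _ _ _ P _ 1).
    rewrite fE// integral_cst// mul1e sube_le0.
    by apply: le_measure; rewrite ?inE//; exact: measurableI.
exists (fun w => Num.max 0 (Num.min 1 (f w))).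
have fver : {ae P, forall w, f w = Num.max 0 (Num.min 1 (f w))}.
  exists (A0 `|` A1); split; [exact: measurableU|exact: null_set_setU|].
  move=> w /= nf; apply: contrapT => /not_orP[].
  rewrite /A0 /A1 /= !in_itv /= andbT => /negP f0 /negP f1; apply: nf.
  by rewrite -leNgt in f0; rewrite -leNgt in f1;
     rewrite (min_idPr f1) (max_idPr f0).
have mf' D : measurable D ->
    <<s C >> ((fun w => Num.max 0 (Num.min 1 (f w))) @^-1` D).
  move=> mD.
  have := mf ((fun x => Num.max 0 (Num.min 1 x)) @^-1` D).
  apply; rewrite -[X in measurable X]setTI.
  by apply: measurable_maxr => //; exact: measurable_minr.
split => //.
- by move=> w; rewrite le_max lexx /= ge_max ler01 ge_min lexx.
- move=> A GA; have mA := generated_measurable GA.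
  rewrite -fE// /Rintegral; congr fine; rewrite [RHS]integral_mkcond.
  apply: ae_eq_integral => //.
  + apply/measurable_EFinP; apply: measurable_funM; last exact: measurable_indic.
    by move=> _ D mD; rewrite setTI; exact: generated_measurable (mf' _ mD).
  + apply/(measurable_restrictT _ mA)/measurable_EFinP.
    exact: measurable_funTS.
  + apply: filterS fver => w <- _.
    by rewrite patchE indicE; case: ifPn => _; rewrite ?mulr1 ?mulr0.
Qed.

End generated.
End conditional_probability.

(** * The function - x log x and its averages *)

Section entropy_function.
Context {R : realType}.
Implicit Types x t : R.

Lemma ln2_gt0 : 0 < ln 2 :> R.
Proof. by rewrite ln_gt0// ltr1n. Qed.

Lemma entropy_termE x : entropy_term x = - (x * ln x) / ln 2.
Proof. by rewrite /entropy_term /log2; ring. Qed.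

Lemma entropy_term0 : entropy_term (0 : R) = 0.
Proof. by rewrite entropy_termE; ring. Qed.

(** The graph of the concave function x |-> - x log x lies below its tangent
    at t; every comparison of entropies below is an average of this. *)
Lemma entropy_term_tangent x t : 0 <= x -> 0 < t ->
  entropy_term x <= (t - x - x * ln t) / ln 2.
Proof.
rewrite le_eqVlt => /predU1P[<- t0|x0 t0].
  by rewrite entropy_term0 subr0 mul0r subr0 divr_ge0 ?ltW// ln2_gt0.
rewrite entropy_termE ler_pM2r ?invr_gt0 ?ln2_gt0//.
have tx0 : 0 < t / x by rewrite divr_gt0.
have : ln (t / x) <= t / x - 1.
  have := @le_ln1Dx R (t / x - 1); rewrite subrKC; apply.
  by rewrite -ltrBlDr opprK addNr.
rewrite ln_div ?posrE// => /(ler_wpM2l (ltW x0)).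
have -> : x * (t / x - 1) = t - x by field; rewrite gt_eqF.
lra.
Qed.

Lemma entropy_term_ge0 x : 0 <= x <= 1 -> 0 <= entropy_term x.
Proof.
move=> /andP[x0 x1]; rewrite entropy_termE.
apply: divr_ge0; last by rewrite ltW// ln2_gt0.
by rewrite oppr_ge0 mulr_ge0_le0// ln_le0.
Qed.

Lemma measurable_entropy_term : measurable_fun setT (@entropy_term R).
Proof.
rewrite (_ : @entropy_term R = fun x => - (x * ln x) * (ln 2)^-1); last first.
  by apply/funext => x; rewrite entropy_termE.
apply: measurable_funM; last exact: measurable_cst.
by apply: measurableT_comp => //; apply: measurable_funM => //; exact: measurable_ln.
Qed.

Lemma mulr_ln_max x t : 0 <= x -> 0 < t -> x * ln x <= x * ln (Num.max x t).
Proof.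
rewrite le_eqVlt => /predU1P[<-|x0] t0; first by rewrite !mul0r.
rewrite ler_pM2l// ler_ln ?posrE//; last by rewrite lt_max x0.
by rewrite le_max lexx.
Qed.

(** Tangent inequality at max y t rather than at y, where log may blow up. *)
Lemma entropy_term_near x y t : 0 <= x <= 1 -> 0 <= y <= 1 -> 0 < t <= 1 ->
  entropy_term x <= entropy_term y + (t + (1 - ln t) * `|x - y|) / ln 2.
Proof.
move=> /andP[x0 x1] /andP[y0 y1] /andP[t0 t1].
set s := Num.max y t.
have s0 : 0 < s by rewrite lt_max t0 orbT.
have s1 : s <= 1 by rewrite ge_max y1 t1.
have lns0 : ln s <= 0 by rewrite ln_le0.
have lnts : ln t <= ln s by rewrite ler_ln ?posrE// le_max lexx orbT.
apply: (le_trans (entropy_term_tangent x0 s0)).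
rewrite entropy_termE -mulrDl ler_pM2r ?invr_gt0 ?ln2_gt0//.
have sy : s <= y + t by rewrite ge_max lerDl lerDr y0 ltW.
have ys := mulr_ln_max y0 t0; rewrite -/s in ys.
have xy : (y - x) * ln s <= `|x - y| * - ln t.
  apply: (le_trans (ler_norm _)); rewrite normrM distrC ler_wpM2l//.
  by rewrite ler0_norm// lerN2.
have := ler_norm (y - x); rewrite distrC => xy'.
move: xy; rewrite mulrBl mulrN => xy; rewrite mulrBl mul1r [ln t * _]mulrC; lra.
Qed.

End entropy_function.

Section conditional_frequency.
Context {d : measure_display} {T : measurableType d} {R : realType}.
Variable P : probability T R.
Context {V : choiceType}.
Implicit Types (B : set T) (W : T -> V) (f : T -> R).

Local Notation Ex := (Rintegral P setT).

(** Division by zero makes this 0 where W = u has probability 0. *)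
Definition cond_freq B W u : R :=
  fine (P (B `&` W @^-1` [set u])) / fine (P (W @^-1` [set u])).

Lemma prob_fine_ge0 B : 0 <= fine (P B).
Proof. exact: fine_ge0 (measure_ge0 P B). Qed.

Lemma prob_fine0 : fine (P set0) = 0.
Proof. by have -> : P set0 = 0%E by exact: (measure0 P). Qed.

Lemma le_prob_fine (A B : set T) : measurable A -> measurable B -> A `<=` B ->
  fine (P A) <= fine (P B).
Proof.
move=> mA mB AB; apply: fine_le; [exact: (fin_num_measure P)..|].
by apply: (le_measure P) => //; rewrite inE.
Qed.

Variables (B : set T) (W : T -> V).
Hypotheses (mB : measurable B) (fW : finitely_valued W).

Let mW u : measurable (W @^-1` [set u]).
Proof. by have [_ h] := fW; exact: h. Qed.

Lemma cond_freqM u :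
  cond_freq B W u * fine (P (W @^-1` [set u])) =
  fine (P (B `&` W @^-1` [set u])).
Proof.
rewrite /cond_freq; have [Pu0|Pu0] := eqVneq (fine (P (W @^-1` [set u]))) 0.
  rewrite Pu0 mulr0; apply/esym/eqP; rewrite eq_le prob_fine_ge0 andbT -Pu0.
  by apply: le_prob_fine => //; exact: measurableI.
by rewrite mulfVK.
Qed.

Lemma cond_freq01 u : 0 <= cond_freq B W u <= 1.
Proof.
rewrite divr_ge0 ?prob_fine_ge0//=.
have [Pu0|Pu0] := eqVneq (fine (P (W @^-1` [set u]))) 0.
  by rewrite /cond_freq Pu0 invr0 mulr0.
rewrite ler_pdivrMr ?mul1r; last by rewrite lt_neqAle eq_sym Pu0 prob_fine_ge0.
by apply: le_prob_fine => //; exact: measurableI.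
Qed.

Lemma bounded_entropy_term f : measurable_fun setT f ->
  (forall w, 0 <= f w <= 1) -> bounded_measurable (entropy_term \o f).
Proof.
move=> mf f01; split; first exact: measurableT_comp measurable_entropy_term mf.
exists (1 / ln 2) => w /=; rewrite ger0_norm ?entropy_term_ge0//.
apply: (le_trans (@entropy_term_tangent _ _ 1 _ _)) => //.
  by case/andP: (f01 w).
rewrite ler_pM2r ?invr_gt0 ?ln2_gt0// ln1 mulr0 subr0 gerBl.
by case/andP: (f01 w).
Qed.

(** In the rest of this section f is a finer conditional probability of B than
    the one given by the value of W. *)
Variable f : T -> R.
Hypotheses (mf : measurable_fun setT f) (f01 : forall w, 0 <= f w <= 1).
Hypothesis fB : forall u, Ex (fun w => f w * \1_(W @^-1` [set u]) w) =
  fine (P (B `&` W @^-1` [set u])).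

Let bf : bounded_measurable f.
Proof.
split => //; exists 1 => w; have /andP[f0 f1] := f01 w.
by rewrite ger0_norm.
Qed.

Let q := cond_freq B W \o W.

Let bF (F : V -> R) : bounded_measurable (F \o W) := bounded_measurable_fun_of fW F.

Let bq : bounded_measurable q := bF _.

(** That is, q is the conditional expectation of f given W. *)
Lemma mean_cond_freqM (F : V -> R) :
  Ex (fun w => f w * F (W w)) = Ex (fun w => q w * F (W w)).
Proof.
rewrite mean_fun_of// (mean_fun_of1 P fW (fun u => cond_freq B W u * F u)).
by apply: eq_fsbigr => u _; rewrite fB -cond_freqM mulrA [F u * _]mulrC.
Qed.

Lemma mean_cond_freq : Ex f = Ex q.
Proof.
have := mean_cond_freqM (fun=> 1).
by under eq_fun do rewrite mulr1; under [X in _ = Rintegral _ _ X]eq_fun do rewrite mulr1.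
Qed.

(** Jensen's inequality for the conditional expectation q of f: average the
    tangent inequality at q, truncated below at t because q may vanish. *)
Lemma le_mean_entropy_cond_freq :
  Ex (entropy_term \o f) <= Ex (entropy_term \o q).
Proof.
have q01 w : 0 <= q w <= 1 by exact: cond_freq01.
apply/ler_addgt0Pr => e e0; set t : R := e * ln 2.
have t0 : 0 < t by rewrite mulr_gt0 ?ln2_gt0.
pose s := fun u => Num.max (cond_freq B W u) t.
have bs : bounded_measurable (s \o W) by exact: bF.
have bl : bounded_measurable (fun w => ln (s (W w))) := bF (@ln R \o s).
have split_tangent h : bounded_measurable h ->
    Ex (fun w => (ln 2)^-1 * (s (W w) - h w - h w * ln (s (W w)))) =
    (ln 2)^-1 * (Ex (s \o W) - Ex h - Ex (fun w => h w * ln (s (W w)))).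
  move=> bh; have bsh := bounded_measurableB bs bh.
  have bhl := bounded_measurableM bh bl.
  rewrite meanZ; last exact: bounded_measurableB bsh bhl.
  by rewrite (meanB P bsh bhl) (meanB P bs bh).
have btangent h : bounded_measurable h ->
    bounded_measurable (fun w => (ln 2)^-1 * (s (W w) - h w - h w * ln (s (W w)))).
  move=> bh; apply: bounded_measurableM; first exact: bounded_measurable_cst.
  exact: bounded_measurableB (bounded_measurableB bs bh) (bounded_measurableM bh bl).
have bef := bounded_entropy_term mf f01.
have beq : bounded_measurable (entropy_term \o q) := bF (entropy_term \o cond_freq B W).
apply: (@le_trans _ _
    (Ex (fun w => (ln 2)^-1 * (s (W w) - f w - f w * ln (s (W w)))))).
  apply: le_mean => // [|w]; first exact: btangent.
  rewrite mulrC; apply: entropy_term_tangent; first by case/andP: (f01 w).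
  by rewrite lt_max t0 orbT.
rewrite split_tangent// mean_cond_freq (mean_cond_freqM (@ln R \o s)).
rewrite -split_tangent//.
rewrite -(mean_cst P e) -meanD//; last exact: bounded_measurable_cst.
apply: le_mean => // [||w]; first exact: btangent.
  by apply: bounded_measurableD => //; exact: bounded_measurable_cst.
have -> : e = t / ln 2 by rewrite /t mulfK// gt_eqF// ln2_gt0.
rewrite /= entropy_termE [leLHS]mulrC -mulrDl.
rewrite ler_pM2r ?invr_gt0 ?ln2_gt0//.
have /andP[q0 q1] := q01 w.
have := mulr_ln_max q0 t0; rewrite -/(s (W w)).
have : s (W w) <= q w + t by rewrite ge_max lerDl lerDr q0 ltW.
lra.
Qed.

(** Averaging over the values of W contracts L1 distances to functions of W. *)
Lemma mean_dist_cond_freq (G : V -> R) :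
  Ex (fun w => `|q w - f w|) <= 2 * Ex (fun w => `|f w - G (W w)|).
Proof.
have bG : bounded_measurable (fun w => G (W w)) := bF G.
pose S u := Num.sg (cond_freq B W u - G u).
have bS : bounded_measurable (fun w => S (W w)) := bF S.
(* The sign of q - G is a function of W, so f can replace q under the mean. *)
have qG : Ex (fun w => `|q w - G (W w)|) <= Ex (fun w => `|f w - G (W w)|).
  have -> : Ex (fun w => `|q w - G (W w)|) =
      Ex (fun w => (f w - G (W w)) * S (W w)).
    transitivity (Ex (fun w => q w * S (W w) - G (W w) * S (W w))).
      congr Rintegral; apply/funext => w.
      by rewrite normrEsg /S -/(q w) -mulrBl mulrC.
    have bqS := bounded_measurableM bq bS; have bGS := bounded_measurableM bG bS.
    have bfS := bounded_measurableM bf bS.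
    rewrite meanB// -mean_cond_freqM -meanB//.
    by congr Rintegral; apply/funext => w; rewrite mulrBl.
  have bfG := bounded_measurableB bf bG.
  apply: le_mean => [||w]; first exact: bounded_measurableM.
    exact: bounded_measurable_norm.
  rewrite (le_trans (ler_norm _))// normrM ler_piMr//.
  by rewrite normr_sg; case: (_ == _).
have bqG := bounded_measurable_norm (bounded_measurableB bq bG).
have bfG := bounded_measurable_norm (bounded_measurableB bf bG).
apply: (@le_trans _ _ (Ex (fun w => `|q w - G (W w)| + `|f w - G (W w)|))).
  apply: le_mean => [||w].
  - exact/bounded_measurable_norm/bounded_measurableB.
  - exact: bounded_measurableD.
  - by rewrite (distrC (f w)) ler_distD.
by rewrite meanD// mulr_natl mulr2n lerD2r.
Qed.

Lemma mean_entropy_cond_freq_near (G : V -> R) (t : R) : 0 < t <= 1 ->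
  Ex (entropy_term \o q) <= Ex (entropy_term \o f) +
    (t + (1 - ln t) * (2 * Ex (fun w => `|f w - G (W w)|))) / ln 2.
Proof.
move=> t01; have /andP[t0 t1] := t01.
have q01 w : 0 <= q w <= 1 by exact: cond_freq01.
have bef := bounded_entropy_term mf f01.
have beq : bounded_measurable (entropy_term \o q) := bF (entropy_term \o cond_freq B W).
have bqf := bounded_measurable_norm (bounded_measurableB bq bf).
have blin : bounded_measurable (fun w => (1 - ln t) * `|q w - f w|).
  by apply: bounded_measurableM => //; exact: bounded_measurable_cst.
have bt := bounded_measurable_cst (T := T) t.
have btl := bounded_measurableD bt blin.
have bmul : bounded_measurable
    (fun w => (ln 2)^-1 * (t + (1 - ln t) * `|q w - f w|)).
  by apply: bounded_measurableM => //; exact: bounded_measurable_cst.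
apply: (@le_trans _ _ (Ex (fun w => (entropy_term \o f) w +
    (ln 2)^-1 * (t + (1 - ln t) * `|q w - f w|)))).
  apply: le_mean => // [|w]; first exact: bounded_measurableD.
  by rewrite [_^-1 * _]mulrC; exact: entropy_term_near.
rewrite meanD// lerD2l meanZ// mulrC ler_pM2r ?invr_gt0 ?ln2_gt0//.
rewrite meanD// mean_cst lerD2l meanZ// ler_wpM2l//.
  by rewrite subr_ge0 (le_trans (ln_le0 t1)).
exact: mean_dist_cond_freq.
Qed.

End conditional_frequency.

(** * Approximation by functions of finitely many coordinates *)

Definition int_window (n : nat) : set int := [set i | - n%:Z <= i <= n%:Z].

Lemma finite_int_window n : finite_set (int_window n).
Proof.
apply: (@sub_finite_set _ _ ((fun k : nat => k%:Z - n%:Z) @` `I_(2 * n).+1)).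
  move=> i /= /andP[ni iN]; exists (absz (i + n%:Z)); last by lia.
  by rewrite /=; lia.
exact/finite_image/finite_II.
Qed.

Lemma subset_int_window m n : (m <= n)%N -> int_window m `<=` int_window n.
Proof. by move=> mn i /= /andP[mi im]; apply/andP; split; lia. Qed.

Lemma mem_int_window (i : int) n : (absz i <= n)%N -> int_window n i.
Proof. by move=> ni; rewrite /int_window /=; apply/andP; split; lia. Qed.

Section restrict_family.
Context {aT : pointedType} {R : realType}.
Implicit Types (f : int -> aT -> R) (s B : set int).

Lemma restrict_preimage1 f s v : [set w | (f^~ w) \_ s = v] =
  (if pselect (forall i, ~ s i -> v i = 0)
   then \bigcap_(i in s) (f i @^-1` [set v i]) else set0).
Proof.
apply/seteqP; split => w /=.
  move=> <-; case: pselect => /= [_ i si|[]].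
    by rewrite /= patchE mem_set.
  by move=> i si; rewrite patchE memNset.
case: pselect => //= v0 fv; apply/funext => i; rewrite patchE.
by case: ifPn; [rewrite inE => /fv|move=> /negP si; rewrite v0// => /mem_set].
Qed.

Lemma sigma_family_restrict f B s v : finite_set s -> s `<=` B ->
  sigma_family f B [set w | (f^~ w) \_ s = v].
Proof.
move=> fs sB; rewrite restrict_preimage1; case: pselect => /= _; last first.
  exact: sigma_algebra0.
pose C := \bigcup_(i in B) preimage_set_system setT (f i) measurable.
apply: (@fin_bigcap_measurable _ (g_sigma_algebraType C)) => // i si.
apply: sub_sigma_algebra; exists i; first exact: sB.
by exists [set v i]; rewrite ?setTI.
Qed.

End restrict_family.

Section coordinates.
Context {d : measure_display} {T : measurableType d} {R : realType}.
Variable P : probability T R.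
Implicit Types (X : process P) (A B s : set int).

Lemma coords_in X A i w : A i -> coords X A w i = X i w.
Proof. by move=> Ai; rewrite /coords patchE mem_set. Qed.

Lemma coords_notin X A i w : ~ A i -> coords X A w i = 0.
Proof. by move=> Ai; rewrite /coords patchE memNset. Qed.

Lemma coords_restrict X A B w : A `<=` B -> coords X A w = coords X B w \_ A.
Proof.
move=> AB; apply/funext => i; rewrite patchE; case: ifPn => /=.
  by rewrite inE => Ai; rewrite !coords_in//; exact: AB.
by move=> /negP Ai; rewrite coords_notin// => Ai'; apply: Ai; rewrite inE.
Qed.

Lemma sigma_family_measurable X B (E : set T) :
  sigma_family (fun i => X i) B E -> measurable E.
Proof.
apply: generated_measurable => {}E [i _ [D mD <-]].
exact: measurable_funP.
Qed.

Lemma sigma_family_coords X B s v : finite_set s -> s `<=` B ->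
  sigma_family (fun i => X i) B (coords X s @^-1` [set v]).
Proof. exact: (@sigma_family_restrict T R (fun i => X i : T -> R)). Qed.

Section finite_valued_process.
Variables (X : process P) (S : set R).
Hypotheses (finS : finite_set S) (XS : forall i w, S (X i w)).

Lemma finite_range_coords s : finite_set s -> finite_set (range (coords X s)).
Proof.
move=> /finite_seqP[l ->]; elim: l => [|i l IH].
  apply: (@sub_finite_set _ _ [set (fun=> 0) : int -> R]) => //.
  by move=> _ [w _ <-]; apply/funext => i; rewrite coords_notin.
apply: (@sub_finite_set _ _ ((fun vx : (int -> R) * R =>
    fun j => if j == i then vx.2 else vx.1 j) @` (range (coords X [set` l]) `*` S))).
  move=> _ [w _ <-] /=; exists (coords X [set` l] w, X i w).
    by split => //=; exists w.
  apply/funext => j /=; have [->|ji] := eqVneq j i.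
    by rewrite coords_in//= mem_head.
  have [jl|jl] := pselect ([set` l] j).
    by rewrite !coords_in//= inE; rewrite /= in jl; rewrite jl orbT.
  by rewrite !coords_notin//= inE (negPf ji).
exact/finite_image/finite_setX.
Qed.

Lemma finitely_valued_coords s : finite_set s -> finitely_valued (coords X s).
Proof.
move=> fs; split; first exact: finite_range_coords.
by move=> v; apply: sigma_family_measurable (sigma_family_coords v fs (@subset_refl _ s)).
Qed.

End finite_valued_process.
End coordinates.

Section approximation.
Context {d : measure_display} {T : measurableType d} {R : realType}.
Variable P : probability T R.
Variables (X : process P) (S : set R) (B : set int).
Hypotheses (finS : finite_set S) (XS : forall i w, S (X i w)).

Local Notation Ex := (Rintegral P setT).
Local Notation W n := (coords X (B `&` int_window n)).

Let finB n : finite_set (B `&` int_window n).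
Proof. exact/finite_setIr/finite_int_window. Qed.

Let fW n : finitely_valued (W n).
Proof. exact: (finitely_valued_coords finS). Qed.

Lemma bounded_measurable_fun_of_window n (G : (int -> R) -> R) :
  bounded_measurable (fun w => G (W n w)).
Proof. exact: bounded_measurable_fun_of. Qed.
Let bW := bounded_measurable_fun_of_window.

(** Stated for functions in L1 rather than for events, so that unions become
    maxima and complements become differences. *)
Definition window_approximable (f : T -> R) := forall e, 0 < e ->
  exists n (G : (int -> R) -> R), Ex (fun w => `|f w - G (W n w)|) <= e.

Lemma fun_of_window_widen m n (G : (int -> R) -> R) : (m <= n)%N ->
  (fun w => G (W m w)) = (fun w => G (W n w \_ (B `&` int_window m))).
Proof.
move=> mn; apply/funext => w; congr G; apply: coords_restrict.
by apply: setIS; exact: subset_int_window.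
Qed.

Lemma window_approximable2 f g : window_approximable f -> window_approximable g ->
  forall e, 0 < e -> exists n (F G : (int -> R) -> R),
    Ex (fun w => `|f w - F (W n w)|) <= e /\ Ex (fun w => `|g w - G (W n w)|) <= e.
Proof.
move=> af ag e e0; have [m [F Fe]] := af _ e0; have [n [G Ge]] := ag _ e0.
exists (maxn m n), (fun v => F (v \_ (B `&` int_window m))),
  (fun v => G (v \_ (B `&` int_window n))); split.
- apply: le_trans Fe; rewrite le_eqVlt; apply/orP; left; apply/eqP.
  congr Rintegral; apply/funext => w; congr `|_ - _|.
  by have /(congr1 (@^~ w)) -> := fun_of_window_widen F (leq_maxl m n).
- apply: le_trans Ge; rewrite le_eqVlt; apply/orP; left; apply/eqP.
  congr Rintegral; apply/funext => w; congr `|_ - _|.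
  by have /(congr1 (@^~ w)) -> := fun_of_window_widen G (leq_maxr m n).
Qed.

Lemma window_approximable_max f g :
  bounded_measurable f -> bounded_measurable g ->
  window_approximable f -> window_approximable g ->
  window_approximable (fun w => Num.max (f w) (g w)).
Proof.
move=> bf bg af ag e e0; have e20 : 0 < e / 2 by rewrite divr_gt0.
have [n [F [G [Fe Ge]]]] := window_approximable2 af ag e20.
exists n, (fun v => Num.max (F v) (G v)).
have bF := bW n F; have bG := bW n G.
have bfF := bounded_measurable_norm (bounded_measurableB bf bF).
have bgG := bounded_measurable_norm (bounded_measurableB bg bG).
apply: (@le_trans _ _ (Ex (fun w => `|f w - F (W n w)| + `|g w - G (W n w)|))).
  apply: le_mean => [||w].
  - apply/bounded_measurable_norm/bounded_measurableB; last first.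
      exact: bounded_measurable_max.
    exact: bounded_measurable_max.
  - exact: bounded_measurableD.
  - rewrite ler_norml; apply/andP; split; move: (ler_norm (f w - F (W n w)))
      (ler_norm (g w - G (W n w))) => h1 h2.
    + have := ler_norm (F (W n w) - f w); have := ler_norm (G (W n w) - g w).
      rewrite (distrC (F _)) (distrC (G _)).
      have := normr_ge0 (f w - F (W n w)); have := normr_ge0 (g w - G (W n w)).
      by rewrite /Num.max; do 2 case: ifPn; rewrite -?leNgt; lra.
    + have := normr_ge0 (f w - F (W n w)); have := normr_ge0 (g w - G (W n w)).
      by rewrite /Num.max; do 2 case: ifPn; rewrite -?leNgt; lra.
by rewrite meanD// [leRHS]splitr lerD.
Qed.

Lemma window_approximable_sum f g c :
  bounded_measurable f -> bounded_measurable g ->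
  window_approximable f -> window_approximable g ->
  window_approximable (fun w => f w + c * g w).
Proof.
move=> bf bg af ag e e0; have c0 : 0 < 1 + `|c| by rewrite ltr_pwDl.
have e20 : 0 < e / (1 + `|c|) by rewrite divr_gt0.
have [n [F [G [Fe Ge]]]] := window_approximable2 af ag e20.
exists n, (fun v => F v + c * G v).
have bF := bW n F; have bG := bW n G.
have bfF := bounded_measurable_norm (bounded_measurableB bf bF).
have bgG := bounded_measurable_norm (bounded_measurableB bg bG).
have bc := bounded_measurable_cst (T := T) c.
have bnc := bounded_measurable_cst (T := T) `|c|.
apply: (@le_trans _ _
    (Ex (fun w => `|f w - F (W n w)| + `|c| * `|g w - G (W n w)|))).
  apply: le_mean => [||w].
  - by apply/bounded_measurable_norm/bounded_measurableB;
      apply: bounded_measurableD => //; exact: bounded_measurableM.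
  - by apply: bounded_measurableD => //; exact: bounded_measurableM.
  - by rewrite -normrM opprD addrACA -mulrBr ler_normD.
rewrite meanD//; last exact: bounded_measurableM.
rewrite meanZ//; apply: (@le_trans _ _ (e / (1 + `|c|) + `|c| * (e / (1 + `|c|)))).
  by rewrite lerD// ler_wpM2l.
rewrite le_eqVlt; apply/orP; left; apply/eqP.
by field; rewrite gt_eqF.
Qed.

Lemma window_approximable_cst c : window_approximable (fun=> c).
Proof.
move=> e e0; exists 0%N, (fun=> c).
by under eq_fun do rewrite subrr normr0; rewrite mean_cst ltW.
Qed.

Lemma window_approximable_lim (u : nat -> T -> R) f :
  (forall n, bounded_measurable (u n)) -> bounded_measurable f ->
  (forall n, window_approximable (u n)) ->
  (forall e, 0 < e -> exists n, Ex (fun w => `|f w - u n w|) <= e) ->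
  window_approximable f.
Proof.
move=> bu bf au uf e e0; have e20 : 0 < e / 2 by rewrite divr_gt0.
have [m um] := uf _ e20; have [n [G Gn]] := au m _ e20; exists n, G.
have bG := bW n G.
have bfu := bounded_measurable_norm (bounded_measurableB bf (bu m)).
have buG := bounded_measurable_norm (bounded_measurableB (bu m) bG).
rewrite [leRHS]splitr; apply: le_trans (lerD um Gn).
rewrite -meanD//; apply: le_mean => [||w]; last exact: ler_distD.
  exact/bounded_measurable_norm/bounded_measurableB.
exact: bounded_measurableD.
Qed.

(** The approximable events form a sigma-algebra containing the generators. *)
Lemma sigma_family_approximable A :
  sigma_family (fun i => X i) B A -> window_approximable \1_A.
Proof.
pose D := [set A : set T | measurable A /\ window_approximable \1_A].
suff : sigma_family (fun i => X i) B `<=` D by move=> + /[dup] => /[apply] -[].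
apply: smallest_sub; last first.
  move=> _ [i Bi [Y mY <-]]; split.
    by rewrite setTI -[X in measurable X]setTI; exact: measurable_funP.
  move=> e e0; exists (absz i), (fun v => \1_Y (v i)).
  rewrite (_ : (fun w => _) = (fun=> 0)) ?mean_cst ?ltW//.
  apply/funext => w; rewrite coords_in; last by split => //; exact: mem_int_window.
  by rewrite setTI !indicE -[w \in _]/(X i w \in Y) subrr normr0.
have D0 : D set0.
  by split => //; rewrite indic0; exact: window_approximable_cst.
have DU A' A'' : D A' -> D A'' -> D (A' `|` A'').
  move=> [mA aA] [mA' aA']; split; first exact: measurableU.
  rewrite (_ : \1__ = fun w => Num.max (\1_A' w) (\1_A'' w) :> R).
    by apply: window_approximable_max => //; exact: bounded_measurable_indic.
  apply/funext => w; rewrite !indicE in_setU.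
  by case: (w \in A'); case: (w \in A'');
    rewrite /Num.max /= ?ltxx ?ltr01 ?ltr10.
split => //.
- move=> A' [mA aA]; rewrite setTD; split; first exact: measurableC.
  rewrite (_ : \1__ = fun w => 1 + (- 1) * \1_A' w :> R).
    apply: window_approximable_sum => //; last exact: window_approximable_cst.
      exact: bounded_measurable_cst.
    exact: bounded_measurable_indic.
  by apply/funext => w; rewrite !indicE in_setC; case: (_ \in _) => /=; lra.
- move=> F DF; have mF n : measurable (F n) by have [] := DF n.
  have mUF : measurable (\bigcup_n F n) by exact: bigcupT_measurable.
  split => //; pose U n := \big[setU/set0]_(i < n) F i.
  have DUn n : D (U n) by rewrite /U; elim/big_ind : _.
  have mU n : measurable (U n) by have [] := DUn n.
  apply: (@window_approximable_lim (fun n => \1_(U n))).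
  + by move=> n; exact: bounded_measurable_indic.
  + exact: bounded_measurable_indic.
  + by move=> n; have [] := DUn n.
  + move=> e e0.
    have sub n : U n `<=` \bigcup_k F k by exact: bigsetU_bigcup.
    have UE : \bigcup_n U n = \bigcup_n F n.
      apply/seteqP; split => [w [n _ /sub//]|w [n _ Fn]]; exists n.+1 => //.
      by rewrite /U big_ord_recr; right.
    have ndU : nondecreasing_seq U by move=> i j ij; exact/subsetPset/subset_bigsetU.
    have mUU : measurable (\bigcup_n U n) by rewrite UE.
    have : fine (P (U n)) @[n --> \oo] --> fine (P (\bigcup_k F k)).
      apply: fine_cvg; rewrite fineK; last exact: (fin_num_measure P).
      by have := nondecreasing_cvg_mu (mu := P) mU mUU ndU; rewrite UE.
    move=> /cvgrPdist_le /(_ _ e0) [N _ /(_ N (leqnn N)) /= PN]; exists N.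
    rewrite (_ : (fun w => _) = \1_(\bigcup_k F k `\` U N)).
      rewrite mean_indic; last exact: measurableD.
      have PD : P (\bigcup_k F k `\` U N) = (P (\bigcup_k F k) - P (U N))%E.
        have Plt : (P (\bigcup_k F k) < +oo)%E.
          by rewrite ltey_eq (fin_num_measure P).
        by have := measureD (mu := P) mUF (mU N) Plt; rewrite setIidr.
      rewrite PD fineB ?(fin_num_measure P)//.
      exact: le_trans (ler_norm _) PN.
    apply/funext => w; rewrite !indicE in_setD.
    have [wU|wU] /= := boolP (w \in U N); last by rewrite subr0 andbT ger0_norm.
    rewrite (mem_set (sub N w _)) ?subrr ?normr0//.
    by rewrite inE in wU.
Qed.

(** The sum counts the integers of [1, N x]: it is floor (N x) / N. *)
Lemma layer_sum_near (x : R) N : 0 <= x <= 1 -> (0 < N)%N ->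
  `|x - \sum_(j < N) N%:R^-1 * \1_[set y : R | j.+1%:R <= N%:R * y] x| <= N%:R^-1.
Proof.
move=> /andP[x0 x1] N0.
have N0' : 0 < N%:R :> R by rewrite ltr0n.
have Nx0 : 0 <= N%:R * x by rewrite mulr_ge0.
set m := Num.truncn (N%:R * x).
have mN : (m <= N)%N.
  by rewrite -(ler_nat R) (@le_trans _ _ (N%:R * x)) ?truncn_le// ler_piMr// ltW.
have -> : \sum_(j < N) N%:R^-1 * \1_[set y : R | j.+1%:R <= N%:R * y] x =
    N%:R^-1 * m%:R :> R.
  rewrite -mulr_sumr; congr (_ * _).
  transitivity (\sum_(j < N) ((j < m)%N : nat)%:R : R).
    apply: eq_bigr => j _; rewrite indicE; congr ((nat_of_bool _)%:R).
    by rewrite /m truncn_ge_nat//; apply/idP/idP; rewrite inE.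
  rewrite -natr_sum; congr (_%:R).
  rewrite -(big_mkord xpredT (fun j => nat_of_bool (j < m)%N)).
  rewrite (big_cat_nat (leq0n _) mN) /=.
  rewrite big_nat (eq_bigr (fun=> 1%N)); last by move=> j /= ->.
  rewrite -big_nat sum_nat_const_nat subn0 muln1.
  rewrite big_nat big1 ?addn0// => j /andP[mj _].
  by rewrite ltnNge mj.
have -> : x - N%:R^-1 * m%:R = N%:R^-1 * (N%:R * x - m%:R).
  by rewrite mulrBr mulKf// gt_eqF.
rewrite normrM gtr0_norm ?invr_gt0//.
rewrite ler_piMr ?invr_ge0 ?ltW// ger0_norm ?subr_ge0 ?truncn_le//.
have := @truncnS_gt _ (N%:R * x); rewrite -natr1 -/m; lra.
Qed.

(** Approximate each level set of f; the layer sums converge uniformly to f. *)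
Lemma sigma_family_fun_approximable (f : T -> R) :
  (forall w, 0 <= f w <= 1) ->
  (forall D, measurable D -> sigma_family (fun i => X i) B (f @^-1` D)) ->
  window_approximable f.
Proof.
move=> f01 mf.
have mfT : measurable_fun setT f.
  by move=> _ D mD; rewrite setTI; exact: sigma_family_measurable (mf _ mD).
have bf : bounded_measurable f.
  by split => //; exists 1 => w; have /andP[? ?] := f01 w; rewrite ger0_norm.
pose L N j := f @^-1` [set y : R | j.+1%:R <= N%:R * y].
have mL N j : sigma_family (fun i => X i) B (L N j).
  apply: mf; rewrite (_ : [set _ | _] = (fun y => N%:R * y) @^-1` `[j.+1%:R, +oo[).
    rewrite -[X in measurable X]setTI.
    have mm : measurable_fun [set: R] (fun y : R => N%:R * y).
      by apply: measurable_funM => //; exact: measurable_cst.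
    exact: mm.
  by apply/seteqP; split => y /=; rewrite in_itv /= andbT.
have bL N j : bounded_measurable (\1_(L N j) : T -> R).
  exact: bounded_measurable_indic (sigma_family_measurable (mL N j)).
pose u N w := \sum_(j < N.+1) N.+1%:R^-1 * \1_(L N.+1 j) w : R.
have bu N : bounded_measurable (u N).
  apply: bounded_measurable_sum => j _; apply: bounded_measurableM => //.
  exact: bounded_measurable_cst.
apply: (window_approximable_lim bu bf) => [N|e e0].
- rewrite /u; elim: (index_enum _) => [|j r IH].
    by under eq_fun do rewrite big_nil; exact: window_approximable_cst.
  under eq_fun do rewrite big_cons addrC.
  apply: window_approximable_sum => //; last exact: sigma_family_approximable.
  apply: bounded_measurable_sum => k _; apply: bounded_measurableM => //.
  exact: bounded_measurable_cst.
- have [N _ /(_ N (leqnn N)) NE] :=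
    (@cvgr0Pnorm_le _ _ _ _ _ _).1 (@cvg_harmonic R) _ e0.
  exists N; apply: (@le_trans _ _ (Ex (fun=> e))); last by rewrite mean_cst.
  apply: le_mean => [||w]; last first.
  + apply: le_trans (@layer_sum_near (f w) N.+1 (f01 w) isT) _.
    by apply: le_trans NE; rewrite ler_norm.
  + exact: bounded_measurable_cst.
  + exact/bounded_measurable_norm/bounded_measurableB.
Qed.

End approximation.

(** * Shannon entropy of finitely valued variables *)

Section discrete_entropy.
Context {d : measure_display} {T : measurableType d} {R : realType}.
Variable P : probability T R.

Local Notation Ex := (Rintegral P setT).

(** The names of the blocks of a partition do not matter: this identifies a pair of
    blocks of coordinates with their union, or one coordinate with a block of one. *)
Lemma fsum_range_eq {V V' : choiceType} (Z : T -> V) (Z' : T -> V')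
    (F : set T -> R) : (forall w w', Z w = Z w' <-> Z' w = Z' w') ->
  \sum_(v \in range Z) F (Z @^-1` [set v]) =
  \sum_(v \in range Z') F (Z' @^-1` [set v]).
Proof.
move=> ZZ'; pose r v := xget point [set w | Z w = v].
have rE w : Z (r (Z w)) = Z w.
  by rewrite /r; apply: (@xgetPex _ point [set w' | Z w' = Z w]); exists w.
rewrite (@reindex_fsbig _ _ _ _ _ (Z' \o r) (range Z) (range Z')).
  apply: eq_fsbigr => v /set_mem[w _ <-]; congr F.
  by apply/seteqP; split => w' /= Zw; [apply/ZZ'; rewrite rE|
    rewrite -[RHS]rE; apply/ZZ'].
split.
- by move=> _ [w _ <-] /=; exists (r (Z w)).
- move=> _ _ /set_mem[w _ <-] /set_mem[w' _ <-] /= /ZZ'.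
  by rewrite !rE.
- by move=> _ [w _ <-]; exists (Z w); [exists w|apply/ZZ'; rewrite rE].
Qed.

Lemma shannon_entropy_eq {V V' : choiceType} (Z : T -> V) (Z' : T -> V') :
  (forall w w', Z w = Z w' <-> Z' w = Z' w') ->
  shannon_entropy P Z = shannon_entropy P Z'.
Proof. exact: (fsum_range_eq (fun A => entropy_term (fine (P A)))). Qed.

Lemma shannon_entropy_setT {V : choiceType} (Z : T -> V) :
  shannon_entropy P Z =
  \sum_(v \in setT) entropy_term (fine (P (Z @^-1` [set v]))).
Proof.
apply: fsbig_widen => // v /= [_ nZv].
have -> : Z @^-1` [set v] = set0.
  by apply/seteqP; split => // w /= Zw; apply: nZv; exists w.
by rewrite prob_fine0 entropy_term0.
Qed.

Section pair.
Context {V V' : choiceType} (Z : T -> V) (W : T -> V').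
Hypotheses (fZ : finitely_valued Z) (fW : finitely_valued W).

Let finZ : finite_set (range Z). Proof. by have [] := fZ. Qed.
Let finW : finite_set (range W). Proof. by have [] := fW. Qed.
Let mZ v : measurable (Z @^-1` [set v]). Proof. exact: finitely_valued_preimage. Qed.
Let mW u : measurable (W @^-1` [set u]). Proof. exact: finitely_valued_preimage. Qed.

Let p u := fine (P (W @^-1` [set u])).
Let j v u := fine (P (Z @^-1` [set v] `&` W @^-1` [set u])).

Lemma cond_shannon_entropyE : cond_shannon_entropy P Z W =
  \sum_(v \in range Z)
    Ex (entropy_term \o (cond_freq P (Z @^-1` [set v]) W \o W)).
Proof.
rewrite /cond_shannon_entropy.
under eq_fsbigr do rewrite mulr_fsumr//.
rewrite exchange_fsbig//; apply: eq_fsbigr => v _.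
rewrite (mean_fun_of1 P fW (fun u => entropy_term (cond_freq P (Z @^-1` [set v]) W u))).
by apply: eq_fsbigr => u _; rewrite mulrC.
Qed.

Lemma fsum_joint u : \sum_(v \in range Z) j v u = p u.
Proof.
have := mean_fun_of P fZ (fun=> 1) (bounded_measurable_indic (mW u)).
under [X in Rintegral _ _ X = _]eq_fun do rewrite mulr1.
rewrite /p mean_indic// => ->; apply: eq_fsbigr => v _.
rewrite mul1r /j -mean_indic; last exact: measurableI.
by rewrite setIC indicI.
Qed.

Lemma cond_shannon_entropy_chain : cond_shannon_entropy P Z W =
  shannon_entropy P (fun w => (Z w, W w)) - shannon_entropy P W.
Proof.
apply/eqP; rewrite -subr_eq opprK; apply/eqP.
have -> : shannon_entropy P (fun w => (Z w, W w)) =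
    \sum_(u \in range W) \sum_(v \in range Z) entropy_term (j v u).
  rewrite exchange_fsbig// pair_fsbig//.
  transitivity (\sum_(x \in range Z `*` range W)
      entropy_term (fine (P ((fun w => (Z w, W w)) @^-1` [set x])))).
    apply: fsbig_widen => [_ [w _ <-]|x /= [_ nx]].
      by split; exists w.
    rewrite (_ : _ @^-1` _ = set0) ?prob_fine0 ?entropy_term0//.
    by apply/seteqP; split => // w /= wx; apply: nx; exists w.
  apply: eq_fsbigr => -[v u] _ /=; congr (entropy_term (fine (P _))).
  by apply/seteqP; split => w /= [-> ->].
rewrite /cond_shannon_entropy /shannon_entropy -fsbig_split//=.
apply: eq_fsbigr => u _; rewrite -/(p u).
have log_split v : p u * entropy_term (j v u / p u) =
    entropy_term (j v u) + j v u * log2 (p u).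
  have p0 : 0 <= p u by exact: prob_fine_ge0.
  have j0 : 0 <= j v u by exact: prob_fine_ge0.
  have jp : j v u <= p u by apply: le_prob_fine => //; exact: measurableI.
  have [pu0|pu0] := eqVneq (p u) 0.
    have -> : j v u = 0 by apply/eqP; rewrite eq_le j0 andbT -pu0.
    by rewrite pu0 !mul0r entropy_term0 addr0.
  have pu : 0 < p u by rewrite lt_neqAle eq_sym pu0.
  have [jv0|jv0] := eqVneq (j v u) 0.
    by rewrite jv0 !mul0r entropy_term0 mulr0 addr0.
  have jv : 0 < j v u by rewrite lt_neqAle eq_sym jv0.
  rewrite /entropy_term /log2 ln_div ?posrE//.
  have l2 : ln 2 != 0 :> R by rewrite gt_eqF// ln2_gt0.
  by field; rewrite l2.
rewrite mulr_fsumr//; under eq_fsbigr do rewrite log_split.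
rewrite fsbig_split//= -mulr_fsuml// fsum_joint /entropy_term; ring.
Qed.

End pair.
End discrete_entropy.

(** * Entropy given infinitely many coordinates *)

Section entropy_given_coordinates.
Context {d : measure_display} {T : measurableType d} {R : realType}.
Variable P : probability T R.
Variables (X : process P) (S : set R).
Hypotheses (finS : finite_set S) (XS : forall i w, S (X i w)).

Local Notation Ex := (Rintegral P setT).

Section one_variable.
Context {V : choiceType} (Z : T -> V) (B : set int).
Hypothesis fZ : finitely_valued Z.

Let G := sigma_family (fun i => X i : T -> R) B.
Let W n := coords X (B `&` int_window n).

Let finB n : finite_set (B `&` int_window n).
Proof. exact/finite_setIr/finite_int_window. Qed.

Let mZ v : measurable (Z @^-1` [set v]).
Proof. exact: finitely_valued_preimage. Qed.

Let generator_measurable A :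
  (\bigcup_(i in B) preimage_set_system setT (X i : T -> R) measurable) A ->
  measurable A.
Proof.
by move=> CA; apply: (@sigma_family_measurable _ _ _ P X B); exact: sub_sigma_algebra.
Qed.

Let f_ex v : exists f : T -> R,
  [/\ forall w, 0 <= f w <= 1,
      forall D : set R, measurable D -> G (f @^-1` D),
      forall A, G A -> Ex (fun w => f w * \1_A w) = fine (P (Z @^-1` [set v] `&` A)) &
      {ae P, forall w, cond_prob P G (Z @^-1` [set v]) w = f w}].
Proof.
have [f [f01 mf fE fae]] := cond_prob_version P generator_measurable (mZ v).
by exists f; split => // A GA; rewrite fE// setIC.
Qed.

Let f v := sval (cid (f_ex v)).
Let f01 v w : 0 <= f v w <= 1.
Proof. by rewrite /f; case: cid => ? []. Qed.
Let mf v D : measurable D -> G (f v @^-1` D).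
Proof. by rewrite /f; case: cid => ? [] /= _ + _ _; exact. Qed.
Let fE v A : G A -> Ex (fun w => f v w * \1_A w) = fine (P (Z @^-1` [set v] `&` A)).
Proof. by rewrite /f; case: cid => ? [] /= _ _ + _; exact. Qed.
Let f_ae v : {ae P, forall w, cond_prob P G (Z @^-1` [set v]) w = f v w}.
Proof. by rewrite /f; case: cid => ? []. Qed.

Let mfT v : measurable_fun setT (f v).
Proof. by move=> _ D mD; rewrite setTI; exact: sigma_family_measurable (mf v mD). Qed.

Let bf v : bounded_measurable (f v).
Proof. by split => //; exists 1 => w; have /andP[? ?] := f01 v w; rewrite ger0_norm. Qed.

Let fB v s u : finite_set s -> s `<=` B ->
  Ex (fun w => f v w * \1_(coords X s @^-1` [set u]) w) =
  fine (P (Z @^-1` [set v] `&` coords X s @^-1` [set u])).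
Proof. by move=> fs sB; apply: fE; exact: sigma_family_coords. Qed.

Let limit_entropy := \sum_(v \in range Z) Ex (entropy_term \o f v).

Lemma entropy_given_coordsE : entropy_given_coords Z X B = limit_entropy%:E.
Proof.
have [finZ _] := fZ.
have bef v := bounded_entropy_term (mfT v) (f01 v).
rewrite /entropy_given_coords /sigma_cond_entropy -/G /limit_entropy.
rewrite fsbig_finite//= -mean_sum// mean_EFin; last exact: bounded_measurable_sum.
have ae_all (r : seq V) :
    {ae P, forall w, forall v, v \in r -> cond_prob P G (Z @^-1` [set v]) w = f v w}.
  elim: r => [|v r IH]; first by apply: aeW => w v; rewrite in_nil.
  apply: filterS2 (f_ae v) IH => w fv IH v'; rewrite inE => /orP[/eqP->//|].
  exact: IH.
have mcp v : measurable_fun setT (cond_prob P G (Z @^-1` [set v])).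
  have [mcp _ _] := cond_probP P generator_measurable (mZ v).
  by move=> _ D mD; rewrite setTI; exact: sigma_family_measurable (mcp _ mD).
apply: ae_eq_integral => //.
- apply/measurable_EFinP; under eq_fun do rewrite fsbig_finite//=.
  apply: measurable_sum => v.
  exact: measurableT_comp measurable_entropy_term (mcp v).
- apply/measurable_EFinP; apply: measurable_sum => v.
  exact: measurableT_comp measurable_entropy_term (mfT v).
- apply: filterS (ae_all (fset_set (range Z))) => w cpf _.
  congr EFin; rewrite fsbig_finite//= big_seq [RHS]big_seq.
  by apply: eq_bigr => v vr /=; rewrite cpf.
Qed.

Lemma le_entropy_given_coords s : finite_set s -> s `<=` B ->
  fine (entropy_given_coords Z X B) <= cond_shannon_entropy P Z (coords X s).
Proof.
move=> fs sB; have fW := finitely_valued_coords finS XS fs.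
rewrite entropy_given_coordsE cond_shannon_entropyE//=.
have [finZ _] := fZ; rewrite /limit_entropy !fsbig_finite//=.
apply: ler_sum => v _; apply: le_mean_entropy_cond_freq => // u.
exact: fB.
Qed.

Lemma entropy_given_coords_ge0 : 0 <= fine (entropy_given_coords Z X B).
Proof.
rewrite entropy_given_coordsE /=; apply: fsumr_ge0 => v _; apply: mean_ge0 => w.
exact: entropy_term_ge0.
Qed.

(** Jensen gives the lower bound. For the upper bound, t is chosen small first; the
    window is then taken large enough for an L1 approximation of the conditional
    probability whose error is small even after multiplication by 1 - log t. *)
Lemma cvg_entropy_given_coords :
  cond_shannon_entropy P Z (W n) @[n --> \oo] -->
  fine (entropy_given_coords Z X B).
Proof.
have [finZ _] := fZ.
have fW n := finitely_valued_coords finS XS (finB n).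
rewrite entropy_given_coordsE /= /limit_entropy.
have -> : (fun n => cond_shannon_entropy P Z (W n)) =
    fun n => \sum_(v <- fset_set (range Z))
      Ex (entropy_term \o (cond_freq P (Z @^-1` [set v]) (W n) \o W n)).
  apply/funext => n; rewrite cond_shannon_entropyE//; last exact: fW.
  by rewrite fsbig_finite.
rewrite fsbig_finite//=.
apply: cvg_big => [x| v _]; first exact: add_continuous.
apply/cvgrPdist_le => e e0.
pose t := Num.min 1 (e * ln 2 / 2).
have l2 : 0 < ln 2 :> R := ln2_gt0.
have t0 : 0 < t by rewrite lt_min ltr01 /= !mulr_gt0// invr_gt0.
have t1 : t <= 1 by rewrite ge_min lexx.
have lnt : 0 < 1 - ln t by rewrite subr_gt0 (le_lt_trans (ln_le0 t1)).
pose del := e * ln 2 / 4 / (1 - ln t).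
have del0 : 0 < del by rewrite !mulr_gt0// invr_gt0.
have [m [H Hm]] := sigma_family_fun_approximable finS XS (f01 v) (@mf v) del0.
exists m => // n /= mn.
have fBn u := fB v u (finB n) (@subIsetl _ B (int_window n)).
have lo := le_mean_entropy_cond_freq (mZ v) (fW n) (mfT v) (f01 v) fBn.
rewrite ler0_norm ?subr_le0// opprB lerBlDl.
pose H' := fun u : int -> R => H (u \_ (B `&` int_window m)).
have t01 : 0 < t <= 1 by rewrite t0.
have := mean_entropy_cond_freq_near (mZ v) (fW n) (mfT v) (f01 v) fBn H' t01.
move=> /le_trans; apply; rewrite lerD2l ler_pdivrMr//.
have {}Hm : Ex (fun w => `|f v w - H' (W n w)|) <= del.
  apply: le_trans Hm; rewrite le_eqVlt; apply/orP; left; apply/eqP.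
  congr Rintegral; apply/funext => w; congr `|_ - _|.
  by rewrite /H' /W; have /(congr1 (@^~ w)) <- := fun_of_window_widen X B H mn.
have : (1 - ln t) * (2 * Ex (fun w => `|f v w - H' (W n w)|)) <= e * ln 2 / 2.
  rewrite (_ : e * ln 2 / 2 = (1 - ln t) * (2 * del)).
    by rewrite ler_pM2l// ler_pM2l.
  by rewrite /del; field; rewrite gt_eqF.
have : t <= e * ln 2 / 2 by rewrite ge_min lexx orbT.
lra.
Qed.

End one_variable.

Definition block_entropy (A : set int) : R := shannon_entropy P (coords X A).

(** H(X_A | X_B), which is finite when A is. *)
Definition coords_entropy (A B : set int) : R :=
  fine (entropy_given_coords (coords X A) X B).

Lemma coords_eqP A w w' : coords X A w = coords X A w' <->
  forall i, A i -> X i w = X i w'.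
Proof.
split=> [e i Ai|e]; first by rewrite -(coords_in X w Ai) e coords_in.
apply/funext => i; have [Ai|Ai] := pselect (A i); first by rewrite !coords_in// e.
by rewrite !coords_notin.
Qed.

Lemma cond_shannon_entropy_coords A B : finite_set A -> finite_set B ->
  cond_shannon_entropy P (coords X A) (coords X B) =
  block_entropy (A `|` B) - block_entropy B.
Proof.
move=> fA fB; rewrite cond_shannon_entropy_chain;
  [|exact: (finitely_valued_coords finS XS)..].
congr (_ - _); apply: shannon_entropy_eq => w w'; split.
  move=> [/coords_eqP eA /coords_eqP eB].
  by apply/coords_eqP => i [/eA|/eB].
move=> /coords_eqP e; congr pair; apply/coords_eqP => i ?; apply: e; [by left|by right].
Qed.

Lemma entropy_given_coords_fin A B : finite_set A ->
  entropy_given_coords (coords X A) X B = (coords_entropy A B)%:E.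
Proof.
move=> fA; have fZ := finitely_valued_coords finS XS fA.
by rewrite /coords_entropy entropy_given_coordsE.
Qed.

Lemma entropy_given_coords1 i B :
  entropy_given_coords (X i) X B = (coords_entropy [set i] B)%:E.
Proof.
rewrite -entropy_given_coords_fin; last exact: finite_set1.
rewrite /entropy_given_coords /sigma_cond_entropy; congr (integral _ _ _).
apply/funext => w; congr EFin.
apply: (fsum_range_eq (fun A => entropy_term
  (cond_prob P (sigma_family (fun i => X i : T -> R) B) A w))) => w1 w2.
split=> [e|/coords_eqP]; last exact.
by apply/coords_eqP => _ ->.
Qed.

Section finite_conditioned_set.
Variable A : set int.
Hypothesis fA : finite_set A.
Let fZ := finitely_valued_coords finS XS fA.

Lemma coords_entropy_ge0 B : 0 <= coords_entropy A B.
Proof. exact: entropy_given_coords_ge0. Qed.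

Lemma coords_entropy_le B s : finite_set s -> s `<=` B ->
  coords_entropy A B <= block_entropy (A `|` s) - block_entropy s.
Proof.
move=> fs sB; rewrite -cond_shannon_entropy_coords//.
exact: le_entropy_given_coords.
Qed.

Lemma cvg_coords_entropy B :
  block_entropy (A `|` (B `&` int_window n)) - block_entropy (B `&` int_window n)
    @[n --> \oo] --> coords_entropy A B.
Proof.
have := cvg_entropy_given_coords (B := B) fZ; under eq_fun => n.
  rewrite cond_shannon_entropy_coords//; last exact/finite_setIr/finite_int_window.
over.
exact.
Qed.

Lemma finite_sub_window s : finite_set s ->
  \forall n \near \oo, s `<=` int_window n.
Proof.
move=> /finite_seqP[l ->]; elim: l => [|i l [N _ IH]]; first by exists 0%N.
exists (maxn N (absz i)) => // n /=; rewrite geq_max => /andP[Nn ni] j.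
by rewrite /= inE => /orP[/eqP->|jl]; [exact: mem_int_window|exact: IH].
Qed.

Lemma coords_entropy_finite s : finite_set s ->
  coords_entropy A s = block_entropy (A `|` s) - block_entropy s.
Proof.
move=> fs; rewrite -(cvg_lim _ (cvg_coords_entropy (B := s)))//.
apply: cvg_lim => //; apply: cvg_near_cst; have [N _ sN] := finite_sub_window fs.
by exists N => // n /= /sN /setIidPl ->.
Qed.

(** Entropies given finite parts of B are upper bounds for any larger set, and
    converge to the entropy given B. *)
Lemma coords_entropy_anti B B' : B `<=` B' ->
  coords_entropy A B' <= coords_entropy A B.
Proof.
move=> BB'; have cv := cvg_coords_entropy (B := B).
rewrite -(cvg_lim _ cv)//; apply: limr_ge; first exact: cvgP cv.
near=> n.
apply: coords_entropy_le; first exact/finite_setIr/finite_int_window.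
by move=> i [/BB'].
Unshelve. all: by end_near. Qed.

End finite_conditioned_set.

(** Exact for the windows of B, once they contain A. *)
Lemma coords_entropy_chain A A' B : finite_set A -> finite_set A' ->
  coords_entropy (A `|` A') B =
  coords_entropy A B + coords_entropy A' (A `|` B).
Proof.
move=> fA fA'; have fU : finite_set (A `|` A') by rewrite finite_setU.
rewrite -(cvg_lim _ (cvg_coords_entropy fU (B := B)))//; apply: cvg_lim => //.
have cv := cvgD (cvg_coords_entropy fA (B := B)) (cvg_coords_entropy fA' (B := A `|` B)).
apply: cvg_trans; last exact: cv.
apply: near_eq_cvg.
have [N _ AN] := finite_sub_window fA; exists N => // n /= /AN /setIidPl An.
rewrite addrfctE /= setIUl An [A `|` A']setUC -setUA; ring.
Qed.

End entropy_given_coordinates.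

(** * Stationarity *)

Local Notation shift := Defs.shift.

Section shifts.
Implicit Types s : set int.

Definition unshift s : set int := [set i | s (i - 1)].

Lemma unshiftK s : shift (unshift s) = s.
Proof.
by rewrite /shift /unshift; apply/funext => i /=; rewrite addrK.
Qed.

Lemma iter_shiftE {V : Type} (x : int -> V) (k : nat) i :
  iter k shift x i = x (i + k%:Z).
Proof.
elim: k i => [|k IH] i; first by rewrite addr0.
by rewrite iterS {1}/shift IH -addrA; congr (x (i + _)); lia.
Qed.

Lemma finite_shift s : finite_set s -> finite_set (shift s).
Proof.
move=> fs; apply: (@sub_finite_set _ _ ((fun i => i - 1) @` s)).
  by move=> i si; exists (i + 1) => //; rewrite addrK.
exact: finite_image.
Qed.

Lemma finite_unshift s : finite_set s -> finite_set (unshift s).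
Proof.
move=> fs; apply: (@sub_finite_set _ _ ((fun i => i + 1) @` s)).
  by move=> i si; exists (i - 1) => //; rewrite subrK.
exact: finite_image.
Qed.

End shifts.

Section stationary_entropy.
Context {d : measure_display} {T : measurableType d} {R : realType}.
Variable P : probability T R.
Variables (X : process P) (S : set R).
Hypotheses (finS : finite_set S) (XS : forall i w, S (X i w)).
Hypothesis stX : stationary X.

Lemma block_entropy_shift s : finite_set s ->
  block_entropy X (shift s) = block_entropy X s.
Proof.
move=> fs; have fss := finite_shift fs.
transitivity (shannon_entropy P (fun w => shift (coords X s w))); last first.
  apply: shannon_entropy_eq => w w'; split => [e|->//]; apply/funext => i.
  by have := congr1 (@^~ (i - 1)) e; rewrite /shift /= subrK.
rewrite /block_entropy !shannon_entropy_setT; apply: eq_fsbigr => v _.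
congr (entropy_term (fine _)).
have GA : product_sigma [set x : int -> R | x \_ (shift s) = v].
  exact: (@sigma_family_restrict (int -> R) R (fun i x => x i)).
rewrite -[LHS]/(P [set w | [set x : int -> R | x \_ (shift s) = v] (trajectory X w)]).
by rewrite -(stX GA).
Qed.

(** Window entropies are upper bounds that converge, on both sides; shifting them
    forwards or backwards keeps their values. *)
Lemma coords_entropy_shift A B : finite_set A ->
  coords_entropy X (shift A) (shift B) = coords_entropy X A B.
Proof.
move=> fA; have fsA := finite_shift fA.
apply/eqP; rewrite eq_le; apply/andP; split.
- have cv := cvg_coords_entropy finS XS fA (B := B).
  rewrite -(cvg_lim _ cv)//; apply: limr_ge; first exact: cvgP cv.
  near=> n.
  have fBn : finite_set (B `&` int_window n) by exact/finite_setIr/finite_int_window.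
  rewrite -block_entropy_shift ?finite_setU// -(block_entropy_shift fBn).
  apply: (coords_entropy_le finS XS fsA (finite_shift fBn)).
  by move=> i [].
- have cv := cvg_coords_entropy finS XS fsA (B := shift B).
  rewrite -(cvg_lim _ cv)//; apply: limr_ge; first exact: cvgP cv.
  near=> n.
  have fBn : finite_set (shift B `&` int_window n) by exact/finite_setIr/finite_int_window.
  have fuBn := finite_unshift fBn.
  have -> : shift B `&` int_window n = shift (unshift (shift B `&` int_window n)).
    by rewrite unshiftK.
  rewrite (block_entropy_shift fuBn).
  rewrite (_ : shift A `|` _ = shift (A `|` unshift (shift B `&` int_window n)))//.
  rewrite block_entropy_shift ?finite_setU//.
  apply: (coords_entropy_le finS XS fA fuBn).
  by move=> i [] /=; rewrite /shift subrK.
Unshelve. all: by end_near. Qed.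

Lemma coords_entropy_iter_shift k A B : finite_set A ->
  coords_entropy X (iter k shift A) (iter k shift B) = coords_entropy X A B.
Proof.
move=> fA; suff [] : finite_set (iter k shift A) /\
  coords_entropy X (iter k shift A) (iter k shift B) = coords_entropy X A B by [].
elim: k => [|k [fk <-]]; first by split.
by split; [exact: finite_shift|exact: coords_entropy_shift].
Qed.

End stationary_entropy.

Section random_set.
Context {d : measure_display} {T : measurableType d} {R : realType}.
Variable P : probability T R.
Variable Y : process P.

Local Notation sequences :=
  (g_sigma_algebraType (\bigcup_(i in [set: int])
     preimage_set_system setT (fun x : int -> R => x i) measurable)).

Definition ones (y : sequences) : set int := [set i | y i = 1].

Definition random_set (w : T) : set int := ones (trajectory Y w).

(** Measurability of a functional of the random set, tested on sequence space
    because shifts act there and not on T. *)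
Definition measurable_functional (phi : set int -> R) :=
  measurable_fun setT (phi \o ones).

Lemma measurable_coordinate i : measurable_fun setT (fun y : sequences => (y i : R)).
Proof.
move=> _ D mD; rewrite setTI; apply: sub_sigma_algebra; exists i => //.
by exists D => //; rewrite setTI.
Qed.

Lemma measurable_trajectory : measurable_fun setT (trajectory Y : T -> sequences).
Proof.
apply: (@measurability _ _ _ sequences setT _
  (\bigcup_(i in [set: int])
     preimage_set_system setT (fun x : int -> R => x i) measurable)) => //.
move=> _ [_ [i _ [D mD <-]] <-]; rewrite !setTI.
have mY : measurable_fun setT (Y i : T -> R) by exact: measurable_funP.
by have := mY measurableT D mD; rewrite setTI.
Qed.

Lemma measurable_shift : measurable_fun setT (shift : sequences -> sequences).
Proof.
apply: (@measurability _ _ _ sequences setT _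
  (\bigcup_(i in [set: int])
     preimage_set_system setT (fun x : int -> R => x i) measurable)) => //.
move=> _ [_ [i _ [D mD <-]] <-]; rewrite !setTI.
by have := @measurable_coordinate (i + 1) measurableT D mD; rewrite setTI.
Qed.

Lemma measurable_functional_shift phi : measurable_functional phi ->
  measurable_functional (fun s => phi (shift s)).
Proof. by move=> mphi; exact: (measurableT_comp mphi measurable_shift). Qed.

Lemma measurable_functional_iter_shift k phi : measurable_functional phi ->
  measurable_functional (fun s => phi (iter k shift s)).
Proof.
elim: k phi => //= k IH phi mphi.
exact: (IH _ (measurable_functional_shift mphi)).
Qed.

Lemma measurable_functional_random_set phi : measurable_functional phi ->
  measurable_fun setT (fun w => phi (random_set w)).
Proof. by move=> mphi; exact: (measurableT_comp mphi measurable_trajectory). Qed.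

Lemma measurable_ones i : measurable [set y : sequences | ones y i].
Proof.
by have := @measurable_coordinate i measurableT _ (measurable_set1 1); rewrite setTI.
Qed.

Lemma measurable_functional_mem i phi psi : measurable_functional phi ->
  measurable_functional psi ->
  measurable_functional (fun s => if i \in s then phi s else psi s).
Proof.
move=> mphi mpsi; apply: measurable_fun_ifT => //.
apply: (measurable_fun_bool true); rewrite setTI.
rewrite (_ : _ @^-1` _ = [set y : sequences | ones y i]); first exact: measurable_ones.
by apply/seteqP; split => y /=; [move=> /set_mem|move=> ?; exact/mem_set].
Qed.

Lemma measurable_functional_finite A phi : finite_set A ->
  (forall s, phi s = phi (s `&` A)) -> measurable_functional phi.
Proof.
move=> /finite_seqP[l ->]; elim: l phi => [|i l IH] phi phiA.
  rewrite /measurable_functional (_ : phi \o ones = cst (phi set0)).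
    exact: measurable_cst.
  by apply/funext => y /=; rewrite phiA; congr phi; apply/seteqP; split => j // [].
rewrite (_ : phi = fun s => if i \in s then phi ((s `&` [set` l]) `|` [set i])
                                      else phi (s `&` [set` l])).
  by apply: measurable_functional_mem; apply: IH => s; rewrite -setIA setIid.
apply/funext => s; rewrite phiA; case: ifPn => [|/negP]; rewrite inE => si;
  congr phi; apply/seteqP; split => j /=; rewrite inE.
- by case=> sj /orP[/eqP->|jl]; [right|left].
- by case=> [[sj jl]|->]; rewrite ?eqxx//; split => //; rewrite jl orbT.
- by case=> sj /orP[/eqP ji|jl//]; case: si; rewrite -ji.
- by case=> sj jl; split => //; rewrite jl orbT.
Qed.

Lemma measurable_functional_cvg (phi_ : nat -> set int -> R) phi :
  (forall n, measurable_functional (phi_ n)) ->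
  (forall s, phi_ n s @[n --> \oo] --> phi s) -> measurable_functional phi.
Proof.
move=> mphi cphi; apply: (@measurable_fun_cvg _ _ _ _ (fun n => phi_ n \o ones)) => //.
by move=> y _; exact: cphi.
Qed.

Hypothesis stY : stationary Y.

Local Open Scope ereal_scope.

Lemma integral_random_set_shift phi : measurable_functional phi ->
  (forall s, (0 <= phi s)%R) ->
  \int[P]_w (phi (shift (random_set w)))%:E = \int[P]_w (phi (random_set w))%:E.
Proof.
move=> mphi phi0.
have mt := measurable_trajectory.
have mst := measurableT_comp measurable_shift mt.
have mphi' : measurable_fun setT (EFin \o (phi \o ones)) by exact/measurable_EFinP.
have := @ge0_integral_pushforward _ _ _ _ R _ mt P setT _ measurableT mphi'
  (fun y _ => phi0 (ones y)).
rewrite preimage_setT => E1.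
have := @ge0_integral_pushforward _ _ _ _ R _ mst P setT _ measurableT mphi'
  (fun y _ => phi0 (ones y)).
rewrite preimage_setT => E2.
transitivity (\int[pushforward P (shift \o trajectory Y : T -> sequences)]_y
  (EFin \o (phi \o ones)) y); first by rewrite E2.
transitivity (\int[pushforward P (trajectory Y : T -> sequences)]_y
  (EFin \o (phi \o ones)) y); last by rewrite E1.
by apply: eq_measure_integral => A mA _; exact: stY.
Qed.

Lemma integral_random_set_iter_shift k phi : measurable_functional phi ->
  (forall s, (0 <= phi s)%R) ->
  \int[P]_w (phi (iter k shift (random_set w)))%:E =
  \int[P]_w (phi (random_set w))%:E.
Proof.
move=> mphi phi0; elim: k => //= k <-.
rewrite -[RHS](@integral_random_set_shift (fun s => phi (iter k shift s)))//; last first.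
  exact: measurable_functional_iter_shift.
by apply: eq_integral => w _; rewrite -iterSr.
Qed.

End random_set.

(** * Integration under the conditional law *)

Section conditioning_on_event.
Context {d : measure_display} {T : measurableType d} {R : realType}.
Variable P : probability T R.
Local Open Scope ereal_scope.

(** Integrals of nonnegative functions are suprema over simple functions, hence
    monotone for arbitrary functions. The entropies to be integrated under the
    conditional law only agree almost everywhere with measurable functions. *)
Lemma le_integral_nonmeasurable (f g : T -> \bar R) :
  (forall w, 0 <= f w) -> (forall w, f w <= g w) ->
  \int[P]_w f w <= \int[P]_w g w.
Proof.
move=> f0 fg; have g0 w : 0 <= g w by exact: le_trans (fg w).
rewrite !ge0_integralTE//; apply: le_ereal_sup => _ [h hf <-].
by exists h => // w; exact: le_trans (fg w).
Qed.

(** Squeeze f between g set to 0 and g set to +oo on a null set. *)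
Lemma ae_eq_integral_nonmeasurable (f g : T -> \bar R) :
  (forall w, 0 <= f w) -> (forall w, 0 <= g w) -> measurable_fun setT g ->
  {ae P, forall w, f w = g w} -> \int[P]_w f w = \int[P]_w g w.
Proof.
move=> f0 g0 mg [N [mN N0 subN]].
have fgN w : ~ N w -> f w = g w.
  by move=> Nw; apply: contrapT => fgw; apply: Nw; exact: subN.
pose patch c w := if w \in N then c else g w : \bar R.
have mpatch c : measurable_fun setT (patch c).
  apply: measurable_fun_ifT => //; apply: (measurable_fun_bool true).
  rewrite setTI (_ : _ @^-1` _ = N)//.
  by apply/seteqP; split => w /=; [move=> /set_mem|move=> ?; exact/mem_set].
have ipatch c : \int[P]_w patch c w = \int[P]_w g w.
  apply: ae_eq_integral => //; exists N; split => // w /= nw.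
  apply: contrapT => Nw; apply: nw => _; rewrite /patch memNset//.
apply/eqP; rewrite eq_le; apply/andP; split.
- rewrite -(ipatch +oo); apply: le_integral_nonmeasurable => // w.
  by rewrite /patch; case: ifPn => [|/negP]; rewrite inE; [rewrite leey|move=> /fgN ->].
- rewrite -(ipatch 0); apply: le_integral_nonmeasurable => w.
    by rewrite /patch; case: ifPn.
  by rewrite /patch; case: ifPn => [//|/negP]; rewrite inE => /fgN ->.
Qed.

End conditioning_on_event.

Section given_event.
Context {d : measure_display} {T : measurableType d} {R : realType}.
Variables (P : probability T R) (Y : {RV P >-> R}).
Let D := Y @^-1` [set 1%R].
Hypothesis PD : (0 < P D)%E.
Local Open Scope ereal_scope.

Let mD : measurable D.
Proof. by rewrite -[X in measurable X]setTI; exact: measurable_funP. Qed.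

Let PDfin : P D \is a fin_num.
Proof. exact: fin_num_measure. Qed.

Lemma given_eq1E A : P D * given_eq1 Y A = P (A `&` D).
Proof.
rewrite /given_eq1 /cond_probability /= /mnormalize /= /mrestr setTI -/D.
rewrite gt_eqF//= lt_eqF ?ltey_eq ?PDfin//= muleC -muleA -{2}(fineK PDfin) -EFinM.
by rewrite mulVf ?mule1// fine_eq0// gt_eqF.
Qed.

(** On the subsets of D, P is the conditional law scaled by P D. *)
Lemma integral_given_eq1 (f g : T -> \bar R) :
  (forall w, 0 <= f w) -> (forall w, 0 <= g w) -> measurable_fun setT g ->
  (forall w, Y w <> 1%R -> g w = 0) ->
  {ae P, forall w, Y w = 1%R -> f w = g w} ->
  P D * \int[given_eq1 Y]_w f w = \int[P]_w g w.
Proof.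
move=> f0 g0 mg gD fg.
have fg' : {ae given_eq1 Y, forall w, f w = g w}.
  have [N [mN N0 subN]] := fg.
  exists (N `|` ~` D); split; first by apply: measurableU => //; exact: measurableC.
    apply/eqP; rewrite -[_ == _]orFb -(gt_eqF PD) -mule_eq0 given_eq1E.
    apply/eqP/(@subset_measure0 _ _ _ P _ N) => //.
      by apply: measurableI => //; apply: measurableU => //; exact: measurableC.
    by move=> w [[]].
  move=> w /= fgw; have [Dw|Dw] := pselect (D w); [left|by right].
  by apply: subN => /= /(_ Dw).
rewrite (ae_eq_integral_nonmeasurable f0 g0 mg fg').
have gE : g = g \_ D.
  apply/funext => w; rewrite patchE; case: ifPn => //= /negP; rewrite inE => Dw.
  exact: gD.
rewrite [in LHS]gE [in RHS]gE -!integral_mkcond.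
pose k : {nonneg R} := NngNum (fine_ge0 (ltW PD)).
rewrite -[P D]fineK// -(@ge0_integral_mscale _ _ _ (given_eq1 Y) D mD k g)//; last first.
  exact: measurable_funTS.
apply: eq_measure_integral => A mA AD.
transitivity (P D * given_eq1 Y A); last by rewrite given_eq1E setIidl.
by rewrite -[LHS]/((fine (P D))%:E * given_eq1 Y A) fineK.
Qed.

End given_event.

(** * Cesaro averages *)

Section cesaro_two_sided.
Context {R : realType}.

Lemma cvg_mean_of_increments (a v : nat -> R) (l : R) :
  a 0%N = 0 -> (forall n, a n.+1 - a n = v n) -> v n @[n --> \oo] --> l ->
  a n / n%:R @[n --> \oo] --> l.
Proof.
move=> a0 av vl; rewrite -cvg_shiftS /=.
have -> : (fun n => a n.+1 / n.+1%:R) = arithmetic_mean v; last exact: cesaro.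
apply/funext => n; rewrite /arithmetic_mean /= mulrC; congr (_ * _).
rewrite /series /= -[LHS]subr0 -[X in _ - X]a0 -(telescope_sumr a (leq0n _)).
exact: eq_bigr.
Qed.

(** Along the antidiagonal both arguments are eventually large except near its
    two ends; monotonicity reduces g k (n-1-k) to the diagonal values v at k
    and at n-1-k, to which the one-sided statement applies. *)
Lemma cvg_mean_antidiagonal (g : nat -> nat -> R) (l : R) :
  (forall a b a' b', (a <= a')%N -> (b <= b')%N -> g a' b' <= g a b) ->
  (forall a b, l <= g a b) -> g m m @[m --> \oo] --> l ->
  (\sum_(k < n) g k (n - 1 - k)%N) / n%:R @[n --> \oo] --> l.
Proof.
move=> ganti gl gdiag.
pose v m := g m m - l.
have v0 m : 0 <= v m by rewrite subr_ge0.
have gv a b : g a b <= l + v a + v b.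
  have := gl a a; have := gl b b; rewrite /v.
  by have [ab|/ltnW ba] := leqP a b;
    [have := ganti a a a b (leqnn a) ab|have := ganti b b a b ba (leqnn b)]; lra.
have cv : v n @[n --> \oo] --> 0.
  by rewrite -(subrr l); apply: cvgB => //; exact: cvg_cst.
have csum : (\sum_(k < n) v k) / n%:R @[n --> \oo] --> 0.
  apply: (@cvg_mean_of_increments (fun n => \sum_(k < n) v k) v) => //.
    by rewrite big_ord0.
  by move=> n; rewrite big_ord_recr /= addrAC subrr add0r.
pose c n := (\sum_(k < n) v k) / n%:R.
have cup : l + (c n + c n) @[n --> \oo] --> l.
  rewrite -[X in _ --> X]addr0 -[X in l + X]addr0.
  by apply: cvgD; [exact: cvg_cst|exact: cvgD].
apply: (squeeze_cvgr _ (cvg_cst l) cup).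
exists 1%N => // n /= n1; have n0 : 0 < n%:R :> R by rewrite ltr0n.
have nl : \sum_(k < n) l = l * n%:R by rewrite sumr_const card_ord mulr_natr.
rewrite ler_pdivlMr// ler_pdivrMr// -nl; apply/andP; split.
  by apply: ler_sum => k _.
rewrite mulrDl -nl mulrDl !divfK ?gt_eqF//.
apply: (@le_trans _ _ (\sum_(k < n) (l + v k + v (n - 1 - k)%N))).
  by apply: ler_sum.
have rev : \sum_(k < n) v (n - 1 - k)%N = \sum_(k < n) v k.
  rewrite [RHS](reindex_inj rev_ord_inj); apply: eq_bigr => k _; congr v.
  by rewrite /=; lia.
by rewrite big_split rev big_split addrA.
Qed.

End cesaro_two_sided.

(** * Entropy of the selected process *)

Section random_block_entropy.
Context {d : measure_display} {T : measurableType d} {R : realType}.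
Variable P : probability T R.
Variables (X Y : process P) (S : set R).
Hypotheses (finS : finite_set S) (XS : forall i w, S (X i w)).
Hypotheses (stX : stationary X) (stY : stationary Y).

Local Notation Ex := (Rintegral P setT).
Local Notation H := (block_entropy X).
Local Notation e := (coords_entropy X).
Local Notation rset := (random_set Y).

Lemma block_entropy0 : H set0 = 0.
Proof.
rewrite /block_entropy /shannon_entropy.
have -> : range (coords X set0) = [set fun=> 0].
  apply/seteqP; split => [_ [w _ <-]|_ ->].
    by apply/funext => i; rewrite coords_notin.
  by exists point => //; apply/funext => i; rewrite coords_notin.
rewrite fsbig_set1 (_ : _ @^-1` _ = setT).
  have -> : P setT = 1%E by exact: probability_setT.
  by rewrite /= entropy_termE ln1 mulr0 oppr0 mul0r.
by apply/seteqP; split => // w _; apply/funext => i; rewrite coords_notin.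
Qed.

Lemma block_entropy_le A B : finite_set B -> A `<=` B -> H A <= H B.
Proof.
move=> fB AB; have fA := sub_finite_set AB fB.
have := coords_entropy_ge0 finS XS fB A.
by rewrite (coords_entropy_finite finS XS fB fA) subr_ge0 setUidl.
Qed.

Lemma block_entropy_ge0 A : finite_set A -> 0 <= H A.
Proof. by move=> fA; rewrite -block_entropy0; exact: block_entropy_le. Qed.

Lemma coords_entropy1 i B : finite_set B ->
  H (i |` B) - H B = e [set i] B.
Proof. by move=> fB; rewrite (coords_entropy_finite finS XS). Qed.

Lemma coords_entropy_set0 B : e set0 B = 0.
Proof.
have cv := cvg_coords_entropy finS XS (@finite_set0 int) (B := B).
rewrite -(cvg_lim _ cv)//; apply: cvg_lim => //; apply: cvg_near_cst.
by apply: nearW => n; rewrite set0U subrr.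
Qed.

Lemma cvg_coords_entropy_window A B : finite_set A ->
  e A (B `&` int_window n) @[n --> \oo] --> e A B.
Proof.
move=> fA; have := cvg_coords_entropy finS XS fA (B := B).
under eq_fun => n.
  rewrite -(coords_entropy_finite finS XS)//; last exact/finite_setIr/finite_int_window.
over.
exact.
Qed.

(** Dominates all conditional entropies of a single site. *)
Definition site_bound : R := e [set 0] set0.

Lemma coords_entropy1_bounds B : 0 <= e [set 0] B <= site_bound.
Proof.
rewrite (coords_entropy_ge0 finS XS (finite_set1 _)).
exact: (coords_entropy_anti finS XS (finite_set1 _) (@sub0set _ B)).
Qed.

Lemma coords_entropy_site k B :
  e [set k%:Z] B = e [set 0] (iter k shift B).
Proof.
rewrite -(coords_entropy_iter_shift finS XS stX k _ (finite_set1 _)).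
have -> : iter k shift [set k%:Z] = [set 0]; last by [].
by apply/seteqP; split => i; rewrite iter_shiftE /= => h; lia.
Qed.

Section functionals.
Variables (phi : set int -> R) (M : R).
Hypotheses (mphi : measurable_functional phi) (phi0 : forall s, 0 <= phi s <= M).

Lemma bounded_measurable_functional : bounded_measurable (fun w => phi (rset w)).
Proof.
split; first exact: measurable_functional_random_set.
by exists M => w; have /andP[p0 pM] := phi0 (rset w); rewrite ger0_norm.
Qed.

Lemma mean_functional_iter_shift k :
  Ex (fun w => phi (iter k shift (rset w))) = Ex (fun w => phi (rset w)).
Proof.
rewrite /Rintegral (integral_random_set_iter_shift stY)// => s.
by case/andP: (phi0 s).
Qed.

Lemma cvg_mean_functional (phi_ : nat -> set int -> R) :
  (forall n, measurable_functional (phi_ n)) ->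
  (forall n s, 0 <= phi_ n s <= M) ->
  (forall s, phi_ n s @[n --> \oo] --> phi s) ->
  Ex (fun w => phi_ n (rset w)) @[n --> \oo] --> Ex (fun w => phi (rset w)).
Proof.
move=> mphi_ phi_0 cphi.
apply: fine_cvg; rewrite mean_EFin; last exact: bounded_measurable_functional.
have [] := @dominated_convergence _ T R P setT measurableT
  (fun n w => (phi_ n (rset w))%:E) (fun w => (phi (rset w))%:E) (fun=> M%:E).
- by move=> n; apply/measurable_EFinP; exact: measurable_functional_random_set.
- by apply/measurable_EFinP; exact: measurable_functional_random_set.
- by apply: aeW => w _; apply: cvg_EFin; [exact: nearW|exact: cphi].
- exact: finite_measure_integrable_cst.
- apply: aeW => w n _; rewrite lee_fin; have /andP[? ?] := phi_0 n (rset w).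
  by rewrite ger0_norm.
by [].
Qed.

End functionals.

(** Contribution of the site 0 to the entropy of the selected process. *)
Definition past_entropy (s : set int) : R :=
  if 0 \in s then e [set 0] (s `&` [set i | i < 0]) else 0.

Definition past_entropy_window n (s : set int) : R :=
  if 0 \in s then e [set 0] (s `&` [set i | i < 0] `&` int_window n) else 0.

(** Contribution of the site 0 to the entropy that the selection loses, when the
    lost sites are put back from left to right. *)
Definition gap_entropy (s : set int) : R :=
  if 0 \in s then 0 else e [set 0] [set i | i < 0 \/ s i].

Definition gap_entropy_window m n (s : set int) : R :=
  if 0 \in s then 0
  else e [set 0] [set i | - m%:Z <= i <= n%:Z /\ (i < 0 \/ s i)].

Lemma site_bound_ge0 : 0 <= site_bound.
Proof. by have /andP[a b] := coords_entropy1_bounds set0; exact: le_trans b. Qed.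

Lemma past_entropy_window_bounds n s : 0 <= past_entropy_window n s <= site_bound.
Proof.
rewrite /past_entropy_window; case: ifP => _; first exact: coords_entropy1_bounds.
by rewrite lexx site_bound_ge0.
Qed.

Lemma past_entropy_bounds s : 0 <= past_entropy s <= site_bound.
Proof.
rewrite /past_entropy; case: ifP => _; first exact: coords_entropy1_bounds.
by rewrite lexx site_bound_ge0.
Qed.

Lemma gap_entropy_window_bounds m n s :
  0 <= gap_entropy_window m n s <= site_bound.
Proof.
rewrite /gap_entropy_window; case: ifP => _; last exact: coords_entropy1_bounds.
by rewrite lexx site_bound_ge0.
Qed.

Lemma gap_entropy_bounds s : 0 <= gap_entropy s <= site_bound.
Proof.
rewrite /gap_entropy; case: ifP => _; last exact: coords_entropy1_bounds.
by rewrite lexx site_bound_ge0.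
Qed.

Lemma mem0_window s n : (0 \in s `&` int_window n) = (0 \in s).
Proof.
apply/idP/idP; rewrite !inE; first by case.
by move=> s0; split => //; exact: mem_int_window.
Qed.

Lemma mem0_iter_shift n (s : set int) : (0 \in (iter n shift s : set int)) = (n%:Z \in s).
Proof.
have e0 : iter n shift s 0 = s n%:Z by rewrite iter_shiftE add0r.
by apply/idP/idP; rewrite !inE e0.
Qed.

Lemma measurable_past_entropy_window n :
  measurable_functional (past_entropy_window n).
Proof.
apply: (measurable_functional_finite (@finite_int_window n)) => s.
rewrite /past_entropy_window mem0_window; case: (0 \in s); [|exact: erefl].
apply: (congr1 (e [set 0])).
apply/seteqP; split => i; first by move=> [[si i0] iI].
by move=> [[[si _] i0] iI].
Qed.

Lemma measurable_gap_entropy_window m n :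
  measurable_functional (gap_entropy_window m n).
Proof.
apply: (measurable_functional_finite (@finite_int_window (maxn m n))) => s.
rewrite /gap_entropy_window mem0_window; case: (0 \in s); [exact: erefl|].
apply: (congr1 (e [set 0])).
apply/seteqP; split => i /= [iI [i0|si]]; split => //; try by left.
  by right; split => //; move: iI => /andP[? ?]; apply/andP; split; lia.
by right; case: si.
Qed.

Lemma cvg_past_entropy_window s :
  past_entropy_window n s @[n --> \oo] --> past_entropy s.
Proof.
rewrite /past_entropy_window /past_entropy; case: (0 \in s); last exact: cvg_cst.
exact: cvg_coords_entropy_window.
Qed.

Lemma cvg_gap_entropy_window s :
  gap_entropy_window n n s @[n --> \oo] --> gap_entropy s.
Proof.
rewrite /gap_entropy_window /gap_entropy; case: (0 \in s); first exact: cvg_cst.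
have := cvg_coords_entropy_window (B := [set i | i < 0 \/ s i]) (finite_set1 0).
by under eq_fun do rewrite setIC.
Qed.

Lemma measurable_past_entropy : measurable_functional past_entropy.
Proof.
exact: measurable_functional_cvg measurable_past_entropy_window
  cvg_past_entropy_window.
Qed.

Lemma measurable_gap_entropy : measurable_functional gap_entropy.
Proof.
exact: measurable_functional_cvg (fun n => measurable_gap_entropy_window n n)
  cvg_gap_entropy_window.
Qed.

Lemma finite_first_ints n : finite_set (first_ints n).
Proof.
apply: (@sub_finite_set _ _ (int_window n)); last exact: finite_int_window.
by move=> i /= /andP[? ?]; apply/andP; split; lia.
Qed.

(** Chain rule, one site at a time from left to right. *)
Lemma block_entropy_first_intsS n s :
  H (s `&` first_ints n.+1) - H (s `&` first_ints n) =
  past_entropy_window n (iter n shift s).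
Proof.
have fn := finite_setIr s (finite_first_ints n).
rewrite /past_entropy_window mem0_iter_shift; case: ifPn => [/set_mem|/negP] sn.
- have -> : s `&` first_ints n.+1 = n%:Z |` (s `&` first_ints n).
    apply/seteqP; split => i /=.
      move=> [si /andP[i0 iN]]; have [->|ni] := eqVneq i n%:Z; first by left.
      by right; split => //; apply/andP; split; lia.
    by case=> [->|[si /andP[i0 iN]]]; split => //; apply/andP; split; lia.
  rewrite (coords_entropy1 _ fn) coords_entropy_site; apply: (congr1 (e [set 0])).
  apply/seteqP; split => i; rewrite /= !iter_shiftE /=.
    by move=> [si /andP[? ?]]; split; [split => //; lia|apply/andP; split; lia].
  by move=> [[si ?] /andP[? ?]]; split => //; apply/andP; split; lia.
- rewrite (_ : s `&` first_ints n.+1 = s `&` first_ints n) ?subrr//.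
  apply/seteqP; split => i /= [si /andP[i0 iN]]; split => //; apply/andP; split => //.
    have ni : i <> n%:Z by move=> ni; apply: sn; rewrite -ni; exact/mem_set.
    by lia.
  by lia.
Qed.

Definition mean_block_entropy n := Ex (fun w => H (rset w `&` first_ints n)).

Lemma bounded_measurable_block_entropy (A : set int -> set int) n :
  (forall s, A s `<=` first_ints n) -> (forall s, A s = A (s `&` first_ints n)) ->
  bounded_measurable (fun w => H (A (rset w))).
Proof.
move=> An As; apply: (@bounded_measurable_functional (H \o A) (H (first_ints n))).
  by apply: (measurable_functional_finite (finite_first_ints n)) => s /=; rewrite -As.
move=> s /=; have fA := sub_finite_set (An s) (finite_first_ints n).
by rewrite block_entropy_ge0// block_entropy_le//; exact: finite_first_ints.
Qed.

(** Stationarity moves the n-th increment to the site 0, where it converges. *)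
Lemma cvg_mean_block_entropy :
  mean_block_entropy n / n%:R @[n --> \oo] --> Ex (fun w => past_entropy (rset w)).
Proof.
apply: (@cvg_mean_of_increments _ _
  (fun n => Ex (fun w => past_entropy_window n (rset w)))).
- rewrite /mean_block_entropy (_ : (fun w => _) = fun=> 0) ?mean_cst//.
  apply/funext => w; rewrite (_ : _ `&` _ = set0) ?block_entropy0//.
  by apply/seteqP; split => // i /= [_ /andP[? ?]]; lia.
- move=> n; rewrite /mean_block_entropy.
  rewrite -(mean_functional_iter_shift (@measurable_past_entropy_window n)
    (@past_entropy_window_bounds n) n).
  have bb m : (m <= n.+1)%N ->
      bounded_measurable (fun w => H (rset w `&` first_ints m)).
    move=> mn; apply: (@bounded_measurable_block_entropy (fun s => s `&` first_ints m) m).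
      by move=> s; exact: subIsetr.
    by move=> s; rewrite -setIA setIid.
  rewrite -meanB; [|exact: bb..].
  by congr Rintegral; apply/funext => w; rewrite block_entropy_first_intsS.
- apply: (@cvg_mean_functional _ site_bound) => //.
  + exact: measurable_past_entropy.
  + exact: past_entropy_bounds.
  + exact: measurable_past_entropy_window.
  + exact: past_entropy_window_bounds.
  + exact: cvg_past_entropy_window.
Qed.

End random_block_entropy.

(** * Entropy of the gaps *)

Section gaps.
Context {d : measure_display} {T : measurableType d} {R : realType}.
Variable P : probability T R.
Variables (X Y : process P) (S : set R).
Hypotheses (finS : finite_set S) (XS : forall i w, S (X i w)).
Hypotheses (stX : stationary X) (stY : stationary Y).

Local Notation Ex := (Rintegral P setT).
Local Notation H := (block_entropy X).
Local Notation e := (coords_entropy X).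
Local Notation rset := (random_set Y).

(** Interpolates between the selected part of a block, at j = 0, and the whole
    block, at j = n. *)
Definition filled n (j : nat) (s : set int) : set int :=
  [set i | first_ints n i /\ (i < j%:Z \/ s i)].

Lemma finite_filled n j s : finite_set (filled n j s).
Proof.
by apply: sub_finite_set (finite_first_ints n) => i [].
Qed.

(** If k is not selected, putting it back adds its entropy given the sites before
    it, all present by now, and the selected ones after it. *)
Lemma block_entropy_filledS n k s : (k < n)%N ->
  H (filled n k.+1 s) - H (filled n k s) =
  gap_entropy_window X k (n - 1 - k)%N (iter k shift s).
Proof.
move=> kn; rewrite /gap_entropy_window mem0_iter_shift.
case: ifPn => [/set_mem|/negP] sk.
- rewrite (_ : filled n k.+1 s = filled n k s) ?subrr//.
  apply/seteqP; split => i [iI [ik|si]]; split => //; try by right.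
    have [->|ni] := eqVneq i k%:Z; first by right.
    by left; lia.
  by left; lia.
- have -> : filled n k.+1 s = k%:Z |` filled n k s.
    apply/seteqP; split => i.
      move=> [iI [ik|si]]; last by right; split => //; right.
      have [->|ni] := eqVneq i k%:Z; first by left.
      by right; split => //; left; lia.
    case=> [->|[iI [ik|si]]]; last by split => //; right.
      by split; [apply/andP; split; lia|left; lia].
    by split => //; left; lia.
  rewrite (coords_entropy1 finS XS _ (finite_filled _ _ _)).
  rewrite (coords_entropy_site finS XS stX); congr (e _ _).
  apply/seteqP; split => i; rewrite /= !iter_shiftE /=.
    move=> [/andP[? ?] h]; split; first by apply/andP; split; lia.
    by case: h; [left; lia|right].
  move=> [/andP[? ?] h]; split; first by apply/andP; split; lia.
  by case: h; [left; lia|right].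
Qed.

Lemma bounded_measurable_filled n k :
  bounded_measurable (fun w => H (filled n k (rset w))).
Proof.
apply: (@bounded_measurable_block_entropy _ _ _ _ X Y S finS XS (filled n k) n).
  by move=> s i [].
move=> s; apply/seteqP; split => i [iI [ik|si]]; split => //; try by left.
  by right.
by right; case: si.
Qed.

Lemma mean_gap_sum n :
  H (first_ints n) - mean_block_entropy X Y n =
  \sum_(k < n) Ex (fun w => gap_entropy_window X k (n - 1 - k)%N (rset w)).
Proof.
pose t k := Ex (fun w => H (filled n k (rset w))).
have <- : t n = H (first_ints n).
  rewrite -(mean_cst P (H (first_ints n))); congr Rintegral.
  apply/funext => w; congr H; apply/seteqP; split => i; first by case.
  by move=> iI; split => //; left; case/andP: iI.
have <- : t 0%N = mean_block_entropy X Y n.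
  congr Rintegral; apply/funext => w; congr H; apply/seteqP; split => i.
    by move=> [iI [i0|si]]; split => //; case/andP: iI => ? ?; lia.
  by move=> [si iI]; split => //; right.
rewrite -(telescope_sumr t (leq0n n)) big_mkord; apply: eq_bigr => k _.
rewrite /t -meanB; [|exact: bounded_measurable_filled..].
rewrite -(mean_functional_iter_shift stY
  (@measurable_gap_entropy_window _ _ _ _ X k (n - 1 - k)%N)
  (@gap_entropy_window_bounds _ _ _ _ X S finS XS k (n - 1 - k)%N) k).
by congr Rintegral; apply/funext => w; rewrite block_entropy_filledS.
Qed.

Lemma gap_entropy_window_anti m n m' n' s : (m <= m')%N -> (n <= n')%N ->
  gap_entropy_window X m' n' s <= gap_entropy_window X m n s.
Proof.
move=> mm nn; rewrite /gap_entropy_window; case: (0 \in s); first exact: lexx.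
apply: (coords_entropy_anti finS XS (finite_set1 _)) => i /= [/andP[? ?] h].
by split => //; apply/andP; split; lia.
Qed.

Lemma gap_entropy_le m n s : gap_entropy X s <= gap_entropy_window X m n s.
Proof.
rewrite /gap_entropy /gap_entropy_window; case: (0 \in s); first exact: lexx.
by apply: (coords_entropy_anti finS XS (finite_set1 _)) => i /= [].
Qed.

Lemma cvg_mean_gap_entropy :
  (H (first_ints n) - mean_block_entropy X Y n) / n%:R @[n --> \oo] -->
  Ex (fun w => gap_entropy X (rset w)).
Proof.
under eq_fun do rewrite mean_gap_sum.
have bw m n : bounded_measurable (fun w => gap_entropy_window X m n (rset w)).
  exact: bounded_measurable_functional (measurable_gap_entropy_window X m n)
    (gap_entropy_window_bounds finS XS m n).
have bg : bounded_measurable (fun w => gap_entropy X (rset w)).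
  exact: bounded_measurable_functional (measurable_gap_entropy finS XS)
    (gap_entropy_bounds finS XS).
apply: (cvg_mean_antidiagonal
  (g := fun a b => Ex (fun w => gap_entropy_window X a b (rset w)))).
- move=> a b a' b' aa bb; apply: le_mean => [||w]; [exact: bw|exact: bw|].
  exact: gap_entropy_window_anti.
- by move=> a b; apply: le_mean => [||w]; [exact: bg|exact: bw|exact: gap_entropy_le].
- apply: (cvg_mean_functional (Y := Y) (measurable_gap_entropy finS XS)
    (gap_entropy_bounds finS XS) (phi_ := fun m s => gap_entropy_window X m m s)).
  + by move=> n; exact: measurable_gap_entropy_window.
  + by move=> n s; exact: gap_entropy_window_bounds finS XS _ _ _.
  + exact: cvg_gap_entropy_window finS XS.
Qed.

(** The site 0 lies in the gap that follows - (j + 1); j starts from 0 because it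
    will be the index of a series. *)
Definition last_before (j : nat) (s : set int) : Prop :=
  s (- j.+1%:Z) /\ forall i, - j%:Z <= i <= 0 -> ~ s i.

Definition gap_entropy_from j (s : set int) : R :=
  if `[< last_before j s >] then gap_entropy X s else 0.

Lemma gap_entropy_from_bounds j s : 0 <= gap_entropy_from j s <= site_bound X.
Proof.
rewrite /gap_entropy_from; case: ifP => _; first exact: (gap_entropy_bounds finS XS).
by rewrite lexx (site_bound_ge0 finS XS).
Qed.

Lemma measurable_gap_entropy_from j : measurable_functional (gap_entropy_from j).
Proof.
pose ind s : R := if `[< last_before j s >] then 1 else 0.
have mind : measurable_functional ind.
  apply: (measurable_functional_finite (@finite_int_window j.+1)) => s.
  rewrite /ind; congr (if _ then _ else _); apply: asbool_equiv_eq.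
  split => [[sj h]|[[sj _] h]].
    split; first by split => //; apply/andP; split; lia.
    by move=> i ij [si _]; exact: h si.
  split => // i ij si; apply: (h i ij); split => //.
  by move/andP: ij => [? ?]; apply/andP; split; lia.
rewrite (_ : gap_entropy_from j = fun s => ind s * gap_entropy X s).
  exact: measurable_funM mind (measurable_gap_entropy finS XS).
apply/funext => s; rewrite /gap_entropy_from /ind.
by case: ifP => _; rewrite ?mul1r ?mul0r.
Qed.

Lemma eseries_eventually (u : nat -> R) c N :
  (forall n, (N <= n)%N -> \sum_(0 <= k < n) u k = c) ->
  (\sum_(0 <= k <oo) (u k)%:E = c%:E)%E.
Proof.
move=> uc; apply: cvg_lim => //; apply: cvg_near_cst; exists N => // n /= Nn.
by rewrite sumEFin uc.
Qed.

Lemma gap_entropy_sum s : (exists i, i < 0 /\ s i) ->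
  (\sum_(0 <= j <oo) (gap_entropy_from j s)%:E = (gap_entropy X s)%:E)%E.
Proof.
move=> [i0 [i00 si0]]; have [s0|s0] := pselect (s 0).
  have g0 : gap_entropy X s = 0 by rewrite /gap_entropy mem_set.
  apply: (@eseries_eventually _ _ 0%N) => n _; rewrite big1 ?g0// => j _.
  by rewrite /gap_entropy_from g0; case: ifP.
have exs : exists j : nat, `[< s (- j%:Z) >].
  by exists (absz i0); apply/asboolP; rewrite (_ : - _ = i0)//; lia.
case: (ex_minnP exs) => j /asboolP sj jmin.
case: j => [|j] in sj jmin; first by rewrite oppr0 in sj.
(* j + 1 is the least distance from 0 back to a site of s. *)
have lbj k : last_before k s <-> k = j.
  split=> [[sk h]|->].
    have jk : (j <= k)%N by have := jmin k.+1; rewrite ltnS; apply; exact/asboolP.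
    apply/eqP; rewrite eqn_leq jk andbT leqNgt; apply/negP => kj.
    by apply: (h (- j.+1%:Z)) => //; apply/andP; split; lia.
  split => // i /andP[ji i0'] si.
  have := jmin (absz i); rewrite (_ : - `|i|%N%:Z = i); last by lia.
  by move=> /(_ (asboolT si)); lia.
apply: (@eseries_eventually _ _ j.+1) => n jn.
rewrite (bigD1_seq j) ?iota_uniq ?mem_index_iota//= big1 ?addr0.
  by rewrite /gap_entropy_from asboolT//; exact/lbj.
by move=> k kj; rewrite /gap_entropy_from asboolF// => /lbj /eqP; rewrite (negPf kj).
Qed.

(** Filling the gap from left to right, each new site sees the whole past and the
    later selected sites. *)
Lemma coords_entropy_gap m (s : set int) :
  (forall i, 1 <= i <= m%:Z -> ~ s i) ->
  e [set i | 1 <= i <= m%:Z] [set i | i <= 0 \/ s i] =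
  \sum_(0 <= j < m) gap_entropy X (iter j.+1 shift s).
Proof.
elim: m => [|m IH] sm.
  rewrite big_nil (_ : [set _ | _] = set0) ?(coords_entropy_set0 finS XS)//.
  by apply/seteqP; split => // i /= /andP[? ?]; lia.
have fm : finite_set [set i : int | 1 <= i <= m%:Z].
  by apply: sub_finite_set (@finite_int_window m) => i /= /andP[? ?]; apply/andP; split; lia.
rewrite big_nat_recr//= -IH; last first.
  by move=> i /andP[? ?]; apply: sm; apply/andP; split; lia.
rewrite (_ : [set i | 1 <= i <= m.+1%:Z] = [set i | 1 <= i <= m%:Z] `|` [set m.+1%:Z]).
  rewrite (coords_entropy_chain finS XS _ fm (finite_set1 _)); congr (_ + _).
  rewrite (coords_entropy_site finS XS stX) -iterS /gap_entropy mem0_iter_shift.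
  rewrite memNset; last by apply: sm; apply/andP; split; lia.
  have -> : [set i | i < 0 \/ iter m.+1 shift s i] =
      [set i | i < 0 \/ s (i + m.+1%:Z)].
    by apply/funext => i; rewrite /mkset iter_shiftE.
  apply: (congr1 (e [set 0])); apply/seteqP; split => i; rewrite iter_shiftE /=.
    by move=> [/andP[? ?]|[?|?]]; [left; lia|left; lia|right].
  move=> [i0|si]; last by right; right.
  have [i1|i1] := leP (i + m.+1%:Z) 0; first by right; left.
  by left; apply/andP; split; lia.
apply/seteqP; split => i /=.
  move=> /andP[? ?]; have [->|ni] := eqVneq i m.+1%:Z; first by right.
  by left; apply/andP; split; lia.
by case=> [/andP[? ?]|->]; apply/andP; split; lia.
Qed.

Lemma gap_entropy_from_shift j s :
  gap_entropy_from j (iter j.+1 shift s) =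
  if `[< s 0 /\ forall i, 1 <= i <= j.+1%:Z -> ~ s i >]
  then gap_entropy X (iter j.+1 shift s) else 0.
Proof.
rewrite /gap_entropy_from; congr (if _ then _ else _); apply: asbool_equiv_eq.
rewrite /last_before iter_shiftE addNr; split => -[s0 h]; split => // i /andP[? ?].
  have := h (i - j.+1%:Z); rewrite iter_shiftE subrK; apply.
  by apply/andP; split; lia.
by rewrite iter_shiftE; apply: h; apply/andP; split; lia.
Qed.

Lemma coords_entropy_excursion r (s : set int) :
  s 0 -> 0 < r -> s r -> (forall i, 0 < i < r -> ~ s i) ->
  ((e [set i | (1 <= i <= r - 1)%R] [set i | (i <= 0)%R \/ s i])%:E =
   \sum_(0 <= j <oo) (gap_entropy_from j (iter j.+1 shift s))%:E)%E.
Proof.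
move=> s0 r0 sr hr; pose m := (absz r).-1.
have rm : r - 1 = m%:Z by rewrite /m; lia.
rewrite rm coords_entropy_gap; last by move=> i /andP[? ?]; apply: hr; apply/andP; split; lia.
apply/esym/(@eseries_eventually _ _ m) => n mn.
rewrite (big_cat_nat (leq0n m) mn).
have -> : \sum_(m <= j < n) gap_entropy_from j (iter j.+1 shift s) = 0.
  rewrite big_nat big1// => j /andP[mj _].
  rewrite gap_entropy_from_shift asboolF// => -[_ h].
  by apply: (h r) => //; apply/andP; split; lia.
apply: (etrans (addr0 _)); apply: eq_big_nat => j /andP[_ jm].
rewrite gap_entropy_from_shift asboolT//.
by split => // i /andP[? ?]; apply: hr; apply/andP; split; lia.
Qed.

Local Open Scope ereal_scope.

(** The entropy of the gap after 0, as a series that can be integrated term by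
    term; [coords_entropy_excursion] identifies it. *)
Definition excursion_entropy (s : set int) : \bar R :=
  \sum_(0 <= j <oo) (gap_entropy_from j (iter j.+1 shift s))%:E.

Lemma excursion_entropy_ge0 s : 0 <= excursion_entropy s.
Proof.
apply: nneseries_ge0 => j _ _; rewrite lee_fin.
by case/andP: (gap_entropy_from_bounds j (iter j.+1 shift s)).
Qed.

Lemma excursion_entropy0 (s : set int) : ~ s 0%R -> excursion_entropy s = 0.
Proof.
move=> s0; apply: (@eseries_eventually _ _ 0%N) => n _; rewrite big1// => j _.
by rewrite gap_entropy_from_shift asboolF// => -[].
Qed.

Let mterm j : measurable_fun setT
  (fun w => (gap_entropy_from j (iter j.+1 shift (rset w)))%:E).
Proof.
apply/measurable_EFinP.
pose m := measurable_functional_iter_shift j.+1 (measurable_gap_entropy_from j).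
exact: (measurable_functional_random_set Y m).
Qed.

Let term_ge0 j s : 0 <= (gap_entropy_from j s)%:E.
Proof. by rewrite lee_fin; case/andP: (gap_entropy_from_bounds j s). Qed.

Lemma measurable_excursion_entropy :
  measurable_fun setT (fun w => excursion_entropy (rset w)).
Proof.
apply: ge0_emeasurable_sum => j; last by move=> _; exact: mterm.
by move=> w _ _; exact: term_ge0.
Qed.

(** Kac's argument: shifting the j-th term by j+1 turns a sum over the sites of
    the excursion that starts at 0 into a sum over the possible starting points
    of the excursion that contains 0. *)
Lemma integral_excursion_entropy :
  {ae P, forall w, exists i, (i < 0)%R /\ rset w i} ->
  \int[P]_w excursion_entropy (rset w) =
  (Ex (fun w => gap_entropy X (rset w)))%:E.
Proof.
move=> past.
have bg : bounded_measurable (fun w => gap_entropy X (rset w)).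
  exact: bounded_measurable_functional (measurable_gap_entropy finS XS)
    (gap_entropy_bounds finS XS).
have mgf j : measurable_fun setT (fun w => (gap_entropy_from j (rset w))%:E).
  apply/measurable_EFinP.
  exact: (measurable_functional_random_set Y (measurable_gap_entropy_from j)).
rewrite /excursion_entropy (integral_nneseries P measurableT mterm); last first.
  by move=> j w _; exact: term_ge0.
transitivity (\sum_(0 <= j <oo) \int[P]_w (gap_entropy_from j (rset w))%:E).
  apply: eq_eseriesr => j _.
  apply: (integral_random_set_iter_shift stY j.+1 (measurable_gap_entropy_from j)).
  by move=> s; case/andP: (gap_entropy_from_bounds j s).
rewrite -(integral_nneseries P measurableT mgf); last first.
  by move=> j w _; exact: term_ge0.
rewrite mean_EFin//; apply: ae_eq_integral => //.
- apply: ge0_emeasurable_sum => j; last by move=> _; exact: mgf.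
  by move=> w _ _; exact: term_ge0.
- by apply/measurable_EFinP; case: bg.
- by apply: filterS past => w pw _; exact: gap_entropy_sum.
Qed.

End gaps.

(** * Enumeration of the return times *)

Section integer_extrema.
Implicit Types A : set int.

Lemma int_minP A a : A !=set0 -> (forall j, A j -> a <= j) ->
  A (int_min A) /\ forall j, A j -> int_min A <= j.
Proof.
move=> [i0 Ai0] lbA; apply: (@xgetPex _ _ [set m | A m /\ forall j, A j -> m <= j]).
have exn : exists n : nat, `[< A (a + n%:Z) >].
  exists (absz (i0 - a)); apply/asboolP; rewrite (_ : _ + _ = i0)//.
  by have := lbA _ Ai0; lia.
case: (ex_minnP exn) => n /asboolP An nmin; exists (a + n%:Z); split => // j Aj.
have aj := lbA _ Aj; have := nmin (absz (j - a)).
rewrite (_ : a + _ = j); last by lia.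
by move=> /(_ (asboolT Aj)); lia.
Qed.

Lemma int_maxP A a : A !=set0 -> (forall j, A j -> j <= a) ->
  A (int_max A) /\ forall j, A j -> j <= int_max A.
Proof.
move=> [i0 Ai0] ubA; apply: (@xgetPex _ _ [set m | A m /\ forall j, A j -> j <= m]).
have exn : exists n : nat, `[< A (a - n%:Z) >].
  exists (absz (a - i0)); apply/asboolP; rewrite (_ : _ - _ = i0)//.
  by have := ubA _ Ai0; lia.
case: (ex_minnP exn) => n /asboolP An nmin; exists (a - n%:Z); split => // j Aj.
have aj := ubA _ Aj; have := nmin (absz (a - j)).
rewrite (_ : a - _ = j); last by lia.
by move=> /(_ (asboolT Aj)); lia.
Qed.

End integer_extrema.

Section enumeration_of_returns.
Variable s : set int.
Hypothesis s0 : s 0.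
Hypothesis infinite_future : infinite_set [set i | 0 <= i /\ s i].
Hypothesis infinite_past : infinite_set [set i | i <= 0 /\ s i].

Let future a : exists j, a < j /\ s j.
Proof.
apply: contrapT => nex; apply: infinite_future.
apply: sub_finite_set (@finite_int_window (absz a)) => i [i0 si].
have ia : i <= a by rewrite leNgt; apply/negP => ai; apply: nex; exists i.
by apply/andP; split; lia.
Qed.

Let past a : exists j, j < a /\ s j.
Proof.
apply: contrapT => nex; apply: infinite_past.
apply: sub_finite_set (@finite_int_window (absz a)) => i [i0 si].
have ia : a <= i by rewrite leNgt; apply/negP => ai; apply: nex; exists i.
by apply/andP; split; lia.
Qed.

Lemma return_fwd0 : return_fwd s 0 = 0.
Proof.
have [] := @int_minP [set j | 0 <= j /\ s j] 0; first by exists 0.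
  by move=> j [].
move=> [ge0 _] /(_ 0 (conj (lexx 0) s0)) le0.
by apply/eqP; rewrite eq_le; apply/andP; split.
Qed.

Lemma return_fwdS n :
  [/\ return_fwd s n < return_fwd s n.+1, s (return_fwd s n.+1) &
      forall j, return_fwd s n < j -> s j -> return_fwd s n.+1 <= j].
Proof.
have [] := @int_minP [set j | return_fwd s n < j /\ s j] (return_fwd s n).
- by have [j [? ?]] := future (return_fwd s n); exists j.
- by move=> j [/ltW].
by move=> [lt_n s_n] min_n; split => // j nj sj; exact: min_n.
Qed.

Lemma return_bwdS n (a := if n is n'.+1 then return_bwd s n' else return_fwd s 0) :
  [/\ return_bwd s n < a, s (return_bwd s n) &
      forall j, j < a -> s j -> j <= return_bwd s n].
Proof.
have -> : return_bwd s n = int_max [set j | j < a /\ s j] by case: n @a.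
have [] := @int_maxP [set j | j < a /\ s j] a.
- by have [j [? ?]] := past a; exists j.
- by move=> j [/ltW].
by move=> [lt_n s_n] max_n; split => // j nj sj; exact: max_n.
Qed.

Lemma return_fwd_ge n : n%:Z <= return_fwd s n.
Proof.
elim: n => [|n IH]; first by rewrite return_fwd0.
by have [] := return_fwdS n; lia.
Qed.

Lemma return_bwd_le n : return_bwd s n <= - n.+1%:Z.
Proof.
elim: n => [|n IH]; first by have [] := return_bwdS 0; rewrite return_fwd0; lia.
by have [] := return_bwdS n.+1; lia.
Qed.

(** The n-th return is at least n, so every element j of s is passed, hence hit,
    after at most |j| returns. *)
Lemma return_seq_future :
  [set return_seq s i | i in [set i | 0 < i]] = [set i | 0 < i /\ s i].
Proof.
apply/seteqP; split => [_ [[[|n]|n] // _ <-]|j [j0 sj]].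
  rewrite -[return_seq s n.+1]/(return_fwd s n.+1).
  by have [_ sn _] := return_fwdS n;
    split => //; exact: lt_le_trans (return_fwd_ge n.+1).
have [[k kj]|] : (exists k, return_fwd s k.+1 = j) \/ return_fwd s (absz j) < j.
  elim: (absz j) => [|n [ex|IH]]; [by right; rewrite return_fwd0|by left|].
  have [_ _ /(_ j IH sj)] := return_fwdS n.
  by rewrite le_eqVlt => /predU1P[<-|?]; [left; exists n|right].
  by exists k.+1%:Z.
by have := return_fwd_ge (absz j); lia.
Qed.

Lemma return_seq_past :
  [set return_seq s i | i in [set i | i < 0]] = s `&` [set i | i < 0].
Proof.
apply/seteqP; split => [_ [[n|n] // _ <-]|j [sj j0]].
  rewrite -[return_seq s (Negz n)]/(return_bwd s n).
  by have [_ sn _] := return_bwdS n; split => //; exact: le_lt_trans (return_bwd_le n) _.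
have [[k kj]|] : (exists k, return_bwd s k = j) \/ j < return_bwd s (absz j).
  elim: (absz j) => [|n [ex|IH]]; [|by left|].
    have [_ _ /(_ j)] := return_bwdS 0; rewrite return_fwd0 => /(_ j0 sj).
    by rewrite le_eqVlt => /predU1P[->|?]; [left; exists 0%N|right].
  have [_ _ /(_ j IH sj)] := return_bwdS n.+1.
  by rewrite le_eqVlt => /predU1P[->|?]; [left; exists n.+1|right].
  by exists (Negz k).
by have := return_bwd_le (absz j); lia.
Qed.

Lemma return_seq1 :
  [/\ 0 < return_seq s 1, s (return_seq s 1) &
      forall i, 0 < i < return_seq s 1 -> ~ s i].
Proof.
have [] := return_fwdS 0; rewrite return_fwd0 => gt0 s1 min1; split => // i.
by move=> /andP[i0 i1] si; have := min1 i i0 si; rewrite leNgt i1.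
Qed.

End enumeration_of_returns.

(** * Relative entropy rate *)

Section selected_process.
Context {d : measure_display} {T : measurableType d} {R : realType}.
Variable P : probability T R.
Variables (X Y : process P) (S : set R).
Hypotheses (finS : finite_set S) (XS : forall i w, S (X i w)).
Hypothesis Y01 : forall i w, Y i w = 0 \/ Y i w = 1.
Hypothesis indXY : independent_processes X Y.

Local Notation Ex := (Rintegral P setT).

(** Given Y, the process X Y is the independent X read along the selected sites. *)
Lemma cond_shannon_entropy_mul n :
  cond_shannon_entropy P (coords (mul_process X Y) (first_ints n))
    (coords Y (first_ints n)) = mean_block_entropy X Y n.
Proof.
set F := first_ints n; set Z := coords (mul_process X Y) F; set W := coords Y F.
have fF : finite_set F := finite_first_ints n.
have fW : finitely_valued W.
  by apply: (@finitely_valued_coords _ _ _ _ _ [set 0; 1]) => // i w; exact: Y01.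
pose sel (u : int -> R) : set int := ones u `&` F.
have fsel u : finite_set (sel u) by exact: finite_setIr.
have -> : mean_block_entropy X Y n = Ex ((fun u => block_entropy X (sel u)) \o W).
  congr Rintegral; apply/funext => w /=; congr block_entropy.
  apply/seteqP; split => i [Yi Fi]; split => //.
    by rewrite /ones /W /= coords_in.
  by move: Yi; rewrite /ones /W /= coords_in.
rewrite (mean_fun_of1 P fW (fun u => block_entropy X (sel u))).
apply: eq_fsbigr => u _; rewrite [RHS]mulrC.
have [->|pu] := eqVneq (fine (P (W @^-1` [set u]))) 0; first by rewrite !mul0r.
congr (_ * _).
have joint v : fine (P (Z @^-1` [set v] `&` W @^-1` [set u])) =
    fine (P (coords X (sel u) @^-1` [set v])) * fine (P (W @^-1` [set u])).
  have -> : Z @^-1` [set v] `&` W @^-1` [set u] =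
      coords X (sel u) @^-1` [set v] `&` W @^-1` [set u].
    suff ZX w : W w = u -> Z w = coords X (sel u) w.
      by apply/seteqP; split => w /= [Zv Wu]; split => //; rewrite -Zv ZX.
    move=> Wu; apply/funext => i; have [Fi|Fi] := pselect (F i); last first.
      by rewrite /Z !coords_notin// => -[].
    rewrite /Z coords_in// -[LHS]/(X i w * Y i w).
    have Yu : Y i w = u i by rewrite -Wu /W coords_in.
    have [Y0|Y1] := Y01 i w.
      rewrite Y0 mulr0 coords_notin// => -[ui _]; move: ui.
      by rewrite /ones /= -Yu Y0 => /esym/eqP; rewrite oner_eq0.
    by rewrite Y1 mulr1 coords_in//; split => //; rewrite /ones /= -Yu.
  have GX : product_sigma [set x : int -> R | x \_ (sel u) = v].
    exact: (@sigma_family_restrict (int -> R) R (fun i x => x i)).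
  have GY : product_sigma [set y : int -> R | y \_ F = u].
    exact: (@sigma_family_restrict (int -> R) R (fun i x => x i)).
  rewrite -fineM; last 2 first.
  - exact/fin_num_measure/finitely_valued_preimage/(finitely_valued_coords finS XS).
  - exact/fin_num_measure/finitely_valued_preimage.
  by congr fine; exact: indXY GX GY.
rewrite /block_entropy shannon_entropy_setT.
transitivity (\sum_(v \in range Z)
    entropy_term (fine (P (coords X (sel u) @^-1` [set v])))).
  by apply: eq_fsbigr => v _; rewrite joint mulfK.
apply: fsbig_widen => // v /= [_ nZv]; have := joint v.
rewrite (_ : Z @^-1` [set v] = set0); last first.
  by apply/seteqP; split => // w /= Zw; apply: nZv; exists w.
rewrite set0I prob_fine0 => /esym/eqP; rewrite mulf_eq0 (negPf pu) orbF => /eqP ->.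
by rewrite entropy_term0.
Qed.

End selected_process.

Unset Implicit Arguments.
Local Open Scope ereal_scope.

Theorem theorem1p7 (d : measure_display) (T : measurableType d) (R : realType)
    (P : probability T R) (X Y : process P) (hXY : good X Y) :
  (relative_entropy_rate (mul_process X Y) Y)%:E =
    P (Y 0%R @^-1` [set 1%R]) *
    \int[given_eq1 (Y 0%R)]_w
      (fun r : int -> int =>
         entropy_given_coords (X 0%R) X [set r i | i in [set i | (i < 0)%R]])
      (return_process Y w)
  /\
  (ergodic Y ->
   (relative_entropy_rate (mul_process X Y) Y)%:E =
     (entropy_rate X)%:E -
     P (Y 0%R @^-1` [set 1%R]) *
     \int[given_eq1 (Y 0%R)]_w
       (fun r : int -> int =>
          entropy_given_coords (coords X [set i | (1 <= i <= r 1 - 1)%R]) X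
            ([set i | (i <= 0)%R] `|` [set r i | i in [set i | (0 < i)%R]]))
       (return_process Y w)).
Proof.
have [[stX stY] [S finS XS] [Y01 PY] indXY returns] := hXY.
have fin1 := finite_set1 (0%R : int).
have bpast : bounded_measurable (fun w => past_entropy X (random_set Y w)).
  exact: bounded_measurable_functional (measurable_past_entropy finS XS)
    (past_entropy_bounds finS XS).
have cv_sel := cvg_mean_block_entropy finS XS stX stY.
have relE : relative_entropy_rate (mul_process X Y) Y =
    Rintegral P setT (fun w => past_entropy X (random_set Y w)).
  apply: cvg_lim => //.
  under eq_fun do rewrite (cond_shannon_entropy_mul finS XS Y01 indXY).
  exact: cv_sel.
split.
- rewrite relE mean_EFin//; apply/esym/(integral_given_eq1 PY).
  + move=> w; rewrite (entropy_given_coords1 finS XS) lee_fin.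
    exact: (coords_entropy_ge0 finS XS fin1).
  + by move=> w; rewrite lee_fin; case/andP: (past_entropy_bounds finS XS (random_set Y w)).
  + by apply/measurable_EFinP; case: bpast.
  + by move=> w Y0; rewrite /past_entropy memNset.
  + apply: filterS returns => w [fut past] Y0.
    rewrite (entropy_given_coords1 finS XS) /past_entropy mem_set; last exact: Y0.
    by rewrite /return_process (return_seq_past Y0 past).
- move=> _.
  have gapE : Rintegral P setT (fun w => gap_entropy X (random_set Y w)) =
      (entropy_rate X - relative_entropy_rate (mul_process X Y) Y)%R.
    rewrite relE; apply/eqP; rewrite eq_sym subr_eq; apply/eqP.
    apply: cvg_lim => //.
    (* The two averages add up to H(X_[0,n)) / n. *)
    have cv := cvgD (cvg_mean_gap_entropy finS XS stX stY) cv_sel.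
    apply: cvg_trans; last exact: cv.
    by apply: near_eq_cvg; apply: nearW => n; rewrite addrfctE /= -mulrDl subrK.
  have -> : P (Y 0%R @^-1` [set 1%R]) *
     \int[given_eq1 (Y 0%R)]_w
       (fun r : int -> int =>
          entropy_given_coords (coords X [set i | (1 <= i <= r 1 - 1)%R]) X
            ([set i | (i <= 0)%R] `|` [set r i | i in [set i | (0 < i)%R]]))
       (return_process Y w) =
     (Rintegral P setT (fun w => gap_entropy X (random_set Y w)))%:E.
    rewrite -(integral_excursion_entropy finS XS stY); last first.
      apply: filterS returns => w [_ past].
      apply: contrapT => npast; apply: past.
      apply: (@sub_finite_set _ _ [set 0%R]) => // i [i0 Yi].
      apply/eqP; rewrite eq_le i0 leNgt; apply/negP => i_lt0.
      by apply: npast; exists i.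
    have fint (a : int) : finite_set [set i : int | (1 <= i <= a - 1)%R].
      apply: sub_finite_set (@finite_int_window (absz a)) => i /= /andP[? ?].
      by apply/andP; split; lia.
    apply: (integral_given_eq1 PY).
    + move=> w; rewrite (entropy_given_coords_fin finS XS)// lee_fin.
      exact: (coords_entropy_ge0 finS XS).
    + by move=> w; exact: (excursion_entropy_ge0 finS XS).
    + exact: (measurable_excursion_entropy Y finS XS).
    + by move=> w Y0; exact: (excursion_entropy0 X).
    + apply: filterS returns => w [fut past] Y0.
      rewrite (entropy_given_coords_fin finS XS)// /return_process.
      rewrite (return_seq_future Y0 fut).
      have [r0 sr min_r] := return_seq1 Y0 fut.
      rewrite /excursion_entropy -(coords_entropy_excursion finS XS stX Y0 r0 sr min_r).
      congr (coords_entropy X _ _)%:E; apply/seteqP; split => i /=.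
        by case=> [|[]]; [left|right].
      case=> [|si]; first by left.
      by have [i0|i0] := leP i 0%R; [left|right].
  by rewrite gapE -EFinB opprB addrCA subrr addr0.
Qed.
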